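(* Fix $0<c<1/2$ and let $k$ be a sufficiently large integer. Let $m,M\in\mathbb{Z}_+$ with $M=3m^{5/4}$. Let $0<\epsilon<1/2$ and let $\delta$ be a sufficiently small constant multiple of $\epsilon\sqrt{\log(1/\epsilon)}/k^2$. Let $\tau=\Theta(M^{-(k+1)/5}\delta)$. Assume that $m>\max\big(C'(\log(1/\epsilon))^{3},\, k^2/\log(1/\delta)\big)$ for some sufficiently large constant $C'>0$. Then any SQ algorithm which is given access to a distribution $\mathbf{P}$ over $\{0,1\}^M$ such that either $H_0$: $\mathbf{P}=U_M$, or $H_1$: $d_{\mathrm{TV}}\big(\mathbf{P},U_M^{S,\delta/\sqrt{m}}\big)\le\epsilon$ for some unknown subset $S\subseteq[M]$ with $|S|=m$, and which correctly distinguishes between these two cases with probability at least $2/3$, must either make queries of accuracy better than $\sqrt{2\tau}$ or must make at least $2^{\Omega(M^{2/5})}M^{-(k+1)/5}$ statistical queries.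
   Context: $U_M$ is the uniform distribution on $\{0,1\}^M$. For $0\le\delta'\le 1/2$ and $S\subseteq[M]$ with $|S|=m$, $U_M^{S,\delta'}$ is the product distribution on $\{0,1\}^M$ in which coordinate $i$ has mean $1/2+\delta'$ if $i\in S$ and mean $1/2$ otherwise. $d_{\mathrm{TV}}$ denotes total variation distance. An SQ (statistical query) algorithm accesses the unknown distribution $D$ only through a $\mathrm{STAT}(\tau')$ oracle: given a query $f:\{0,1\}^M\to[-1,1]$, the oracle returns some value $v$ with $|v-\mathbf{E}_{X\sim D}[f(X)]|\le\tau'$; $\tau'$ is the tolerance (accuracy) of the query. ''Queries of accuracy better than $\sqrt{2\tau}$'' means queries of tolerance smaller than $\sqrt{2\tau}$. The $\Omega$ hides an absolute constant. *)

(* Defs.v *)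
From HB Require Import structures.
From mathcomp Require Import all_boot all_order all_algebra.
From mathcomp Require Import all_classical all_reals all_analysis.

Set Implicit Arguments.
Unset Strict Implicit.
Unset Printing Implicit Defensive.

Import Order.TTheory GRing.Theory Num.Theory.

Local Open Scope classical_set_scope.
Local Open Scope ring_scope.

Definition cube (M : nat) := {ffun 'I_M -> bool}.

(* A distribution on the finite type [cube M] is given by its probability mass
   function. *)
Definition is_distr (R : realType) (M : nat) (D : cube M -> R) : Prop :=
  (forall x, 0 <= D x) /\ \sum_(x : cube M) D x = 1.

Definition expect (R : realType) (M : nat) (D f : cube M -> R) : R :=
  \sum_(x : cube M) D x * f x.

Definition dTV (R : realType) (M : nat) (D D' : cube M -> R) : R :=
  2^-1 * \sum_(x : cube M) `|D x - D' x|.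

Definition unif (R : realType) (M : nat) : cube M -> R :=
  fun=> (#|{: cube M}|%:R)^-1.

(* U_M^{S,d}: the coordinates are independent, and coordinate i takes the value
   [true] (i.e. 1) with probability 1/2 + d if i \in S and 1/2 otherwise.  This
   is a probability mass function when |d| <= 1/2. *)
Definition coord_mean (R : realType) (M : nat) (S : {set 'I_M}) (d : R)
    (i : 'I_M) : R :=
  if i \in S then 2^-1 + d else 2^-1.

Definition biased (R : realType) (M : nat) (S : {set 'I_M}) (d : R) :
    cube M -> R :=
  fun x => \prod_(i < M)
    (if x i then coord_mean S d i else 1 - coord_mean S d i).

Record query (R : realType) (M : nat) := Query {
  query_fun :> cube M -> R;
  query_tol : R;
  query_range : forall x, -1 <= query_fun x <= 1;
  query_tol_gt0 : 0 < query_tol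
}.

(* An oracle may choose each answer adversarially, as a function of the earlier
   queries and answers (oldest first) and of the current query; [stat_oracle]
   says that every answer is a legal answer of STAT([query_tol f]) for D. *)
Definition oracle (R : realType) (M : nat) :=
  seq (query R M * R) -> query R M -> R.

Definition stat_oracle (R : realType) (M : nat) (D : cube M -> R)
    (O : oracle R M) : Prop :=
  forall h (f : query R M), `|O h f - expect D f| <= query_tol f.

Inductive verdict := SayH0 | SayH1.

(* A deterministic adaptive SQ algorithm.  A randomized one is a family
   [A : T -> sq_alg R M] indexed by the random seed, which is drawn from a
   probability space. *)
Inductive sq_alg (R : realType) (M : nat) :=
| Output of verdict
| Ask of query R M & (R -> sq_alg R M).

(* The queries made, with their answers, and the output, when [a] is run
   against O after history h. *)
Fixpoint run (R : realType) (M : nat) (O : oracle R M)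
    (h : seq (query R M * R)) (a : sq_alg R M) :
    seq (query R M * R) * verdict :=
  match a with
  | Output b => (h, b)
  | Ask f next => let v := O h f in run O (rcons h (f, v)) (next v)
  end.

Definition transcript (R : realType) (M : nat) (O : oracle R M)
    (a : sq_alg R M) : seq (query R M * R) := (run O [::] a).1.

Definition output (R : realType) (M : nat) (O : oracle R M)
    (a : sq_alg R M) : verdict := (run O [::] a).2.

(* Inner probability: the oracle is an arbitrary function, so the success event
   of an algorithm need not be measurable.  For a measurable event E this is
   just p <= Pr E. *)
Definition prob_ge (R : realType) (d : measure_display) (T : measurableType d)
    (Pr : probability T R) (E : set T) (p : R) : Prop :=
  exists F : set T, [/\ measurable F, F `<=` E & (p%:E <= Pr F)%E].

Definition null_hyp (R : realType) (M : nat) (P : cube M -> R) : Prop :=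
  P = @unif R M.

Definition alt_hyp (R : realType) (M m : nat) (delta eps : R)
    (P : cube M -> R) : Prop :=
  is_distr P /\ exists S : {set 'I_M},
    #|S| = m /\ dTV P (biased S (delta / Num.sqrt m%:R)) <= eps.

Definition distinguishes (R : realType) (M : nat) (d : measure_display)
    (T : measurableType d) (Pr : probability T R) (A : T -> sq_alg R M)
    (H0 H1 : (cube M -> R) -> Prop) (p : R) : Prop :=
  (forall P O, H0 P -> stat_oracle P O ->
     prob_ge Pr [set w | output O (A w) = SayH0] p) /\
  (forall P O, H1 P -> stat_oracle P O ->
     prob_ge Pr [set w | output O (A w) = SayH1] p).

(* [tr] is the transcript of a possible run of A, for an input satisfying H0 or
   H1 and some legal behaviour of the oracle. *)
Definition possible_transcript (R : realType) (M : nat) (T : Type)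
    (A : T -> sq_alg R M) (H0 H1 : (cube M -> R) -> Prop)
    (tr : seq (query R M * R)) : Prop :=
  exists P O w,
    [/\ H0 P \/ H1 P, stat_oracle P O & tr = transcript O (A w)].

Definition makes_query_better_than (R : realType) (M : nat) (T : Type)
    (A : T -> sq_alg R M) (H0 H1 : (cube M -> R) -> Prop) (t : R) : Prop :=
  exists tr, possible_transcript A H0 H1 tr /\
    has (fun qa => query_tol qa.1 < t) tr.

(* The number of queries is the worst case over all possible runs. *)
Definition makes_at_least_queries (R : realType) (M : nat) (T : Type)
    (A : T -> sq_alg R M) (H0 H1 : (cube M -> R) -> Prop) (N : R) : Prop :=
  exists tr, possible_transcript A H0 H1 tr /\ N <= (size tr)%:R.

(* Main.v *)
(* Write L = ln (1/eps), t for the number of coordinates of S equal to 1, and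
   X = (2t - m) / sqrt m.  To first order U_M^{S,delta/sqrt m} has density 1 + 2 delta X
   with respect to U_M.  We replace X by a bounded function F of t, close to X
   in L^1, that is orthogonal to all polynomials in t of degree at most k.  Then
   P_S = U_M (1 + 2 delta F) is within eps of U_M^{S,delta/sqrt m}, and since F
   has only Fourier coefficients of degree greater than k, the correlation of
   P_S and P_T is at most (|S :&: T| / m)^(k+1) max |F|^2.  For most pairs S, T
   the overlap is of order m^2 / M, so a query of tolerance sqrt (2 tau) tells
   U_M from P_S for an exponentially small fraction of the sets S only, and
   few queries answered as if the input were U_M leave most S undetected.

   This needs sqrt L to be large compared with k^2; otherwise delta <= eps / 2, so
   that U_M itself satisfies H_1 and nothing distinguishes the two hypotheses. *)

Require Import Defs.
From HB Require Import structures.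
From mathcomp Require Import all_boot all_order all_algebra.
From mathcomp Require Import all_classical all_reals all_analysis.
From mathcomp Require Import measurable_realfun ring lra zify.

Set Implicit Arguments.
Unset Strict Implicit.
Unset Printing Implicit Defensive.

Import Order.TTheory GRing.Theory Num.Theory.

Local Open Scope ring_scope.

(** * Fourier analysis on the cube *)

(** The difficulty is to make F orthogonal, close to X in L^1 and bounded at the same time. Write H
    for the unit of spacing of the extrapolation nodes j^2 H and K = k^2 H for the largest of them.
    The interpolation weights have total size at most 4 / H whatever k is, so the L^1 error has
    order sqrt m / H. The price is paid in sup norm: moving mass by up to K and dividing by the
    binomial weight costs a factor exp(O(K^2 / m)). Taking K of order sqrt (L m), with a small
    constant, balances the two. The sup norm of F is then at most 3 eps^(-1/16), and the L^1 error
    is O(k^2 / sqrt L). Multiplied by delta this error becomes a small multiple of eps, which is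
    where the shape eps sqrt L / k^2 of delta comes from. The loss eps^(-1/8) in max |F|^2 is
    harmless, because one factor delta of delta^2 is available to absorb it: tau contains only the
    first power of delta. The same spare factor absorbs the 7^(k+1) that arises when the overlap
    threshold is compared with m M^(-1/5), since L is then far larger than k. *)

Section Fourier.
Variables (R : realFieldType) (M : nat).

Definition chi (W : {set 'I_M}) (x : cube M) : R := \prod_(i in W) (-1) ^+ x i.

Definition fourier (f : cube M -> R) (W : {set 'I_M}) : R :=
  \sum_x f x * chi W x.

Definition weight (S : {set 'I_M}) (x : cube M) : nat := \sum_(i in S) x i.

Lemma weight_le S x : (weight S x <= #|S|)%N.
Proof.
by rewrite -sum1_card; apply: leq_sum => i _; case: (x i).
Qed.

(** The sum over W is the expansion of the product over coordinates of 1 + (-1)^(x i + y i), and a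
    coordinate where x and y differ annihilates it. *)
Lemma sum_chi_mul (x y : cube M) :
  \sum_W chi W x * chi W y = 2 ^+ M * (x == y)%:R.
Proof.
transitivity (\prod_(i < M) ((-1) ^+ x i * (-1) ^+ y i + 1) : R).
  rewrite bigA_distr; apply: eq_bigr => W _.
  rewrite /chi -big_split /= [LHS]big_mkcond /=; apply: eq_bigr => i _.
  by case: ifP.
have [->|neq] := eqVneq x y.
  rewrite mulr1 -[in RHS](card_ord M) -prodr_const; apply: eq_bigr => i _.
  by case: (y i); rewrite ?expr1 ?expr0; ring.
have [i xi] : exists i, x i != y i.
  apply/existsP; rewrite -negb_forall; apply: contra neq => /forallP xy.
  by apply/eqP/ffunP => i; apply/eqP.
rewrite (bigD1 i) //=; move: xi; case: (x i); case: (y i) => // _.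
  by rewrite expr1 expr0 mulr1 addNr mul0r mulr0.
by rewrite expr1 expr0 mul1r addNr mul0r mulr0.
Qed.

Lemma parseval (f g : cube M -> R) :
  \sum_W fourier f W * fourier g W = 2 ^+ M * \sum_x f x * g x.
Proof.
rewrite /fourier.
under eq_bigr => W _ do rewrite mulr_suml.
rewrite exchange_big /= mulr_sumr; apply: eq_bigr => x _.
under eq_bigr => W _ do rewrite mulr_sumr.
rewrite exchange_big /=.
rewrite (eq_bigr (fun y => f x * g y * (2 ^+ M * (x == y)%:R))); last first.
  move=> y _; rewrite -sum_chi_mul mulr_sumr; apply: eq_bigr => W _.
  by rewrite mulrACA.
rewrite (bigD1 x) //= big1 ?addr0; last first.
  by move=> y; rewrite eq_sym => /negbTE ->; rewrite !mulr0.
by rewrite eqxx mulr1; ring.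
Qed.

(* The sum of F over the coefficients of (1 - X)^j (1 + X)^(m - j), that is,
   2^m times the common Fourier coefficient, at the sets of size j, of the
   function F (weight x) on the cube of dimension m. *)
Definition kraw (m : nat) (F : nat -> R) (j : nat) : R :=
  \sum_(t < m.+1) F t * ((1 - 'X) ^+ j * (1 + 'X) ^+ (m - j) : {poly R})`_t.

(** The generating function factorises over coordinates: 1 - X on W, 1 + X on the rest of S, 2
    outside S. An element of W outside S contributes 1 - 1 = 0. This is the source of the polynomial
    in [kraw]. *)
Lemma sum_chi_weight (S W : {set 'I_M}) :
  \sum_x chi W x *: 'X^(weight S x) =
  if W \subset S then 2 ^+ (M - #|S|) *:
    ((1 - 'X) ^+ #|W| * (1 + 'X) ^+ (#|S| - #|W|)) else 0 :> {poly R}.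
Proof.
pose a (i : 'I_M) (b : bool) : {poly R} :=
  (if i \in W then (-1) ^+ b else 1) *: (if i \in S then 'X^b else 1).
transitivity (\prod_(i < M) \sum_(b : bool) a i b).
  rewrite bigA_distr_bigA /=; apply: eq_bigr => x _.
  rewrite /a scaler_prod /chi [in LHS]big_mkcond; congr (_ *: _).
  rewrite /weight -big_mkcond /=.
  by rewrite (big_morph (fun n => 'X^n) (exprD 'X) (expr0 'X)).
under eq_bigr => i _ do rewrite big_bool /= /a.
case: ifPn => [WS | /fintype.subsetPn [i iW iNS]]; last first.
  rewrite (bigD1 i) //= iW (negbTE iNS) expr1 expr0 scaleN1r scale1r.
  by rewrite addNr mul0r.
rewrite (bigID (fun i => i \in S)) /= mulrC.
rewrite (eq_bigr (fun=> 2%:P)); last first.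
  move=> i iNS; rewrite (negbTE iNS).
  by rewrite (negbTE (contra (fintype.subsetP WS i) iNS)) !scale1r -polyCD.
have -> : \prod_(i | i \notin S) 2%:P = (2 ^+ (M - #|S|))%:P :> {poly R}.
  rewrite (eq_bigl (fun i => i \in ~: S)); last by move=> i; rewrite inE.
  by rewrite prodr_const cardsCs finset.setCK card_ord -polyC_exp.
rewrite mul_polyC; congr (_ *: _).
rewrite (bigID (fun i => i \in W)) /=; congr (_ * _).
  rewrite (eq_bigl (fun i => i \in W)); last first.
    by move=> i; apply/andb_idl/fintype.subsetP.
  rewrite -prodr_const; apply: eq_bigr => i iW.
  rewrite iW (fintype.subsetP WS _ iW) expr1 !expr0 scaleN1r scale1r expr1.
  by rewrite addrC.
rewrite (eq_bigl (fun i => i \in S :\: W)); last first.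
  by move=> i; rewrite inE andbC.
rewrite (_ : (#|S| - #|W|)%N = #|S :\: W|); last first.
  by rewrite cardsD (finset.setIidPr WS).
rewrite -prodr_const; apply: eq_bigr => i.
by rewrite inE => /andP [/negbTE -> ->]; rewrite !scale1r expr1 expr0 addrC.
Qed.

Lemma fourier_weight (S W : {set 'I_M}) (F : nat -> R) :
  fourier (fun x => F (weight S x)) W =
  if W \subset S then 2 ^+ (M - #|S|) * kraw #|S| F #|W| else 0.
Proof.
pose L (p : {poly R}) := \sum_(t < #|S|.+1) F t * p`_t.
transitivity (L (\sum_x chi W x *: 'X^(weight S x))).
  rewrite /L /fourier.
  under [RHS]eq_bigr => t _ do rewrite coef_sum mulr_sumr.
  rewrite exchange_big /=; apply: eq_bigr => x _.
  have lt : (weight S x < #|S|.+1)%N by rewrite ltnS weight_le.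
  rewrite (bigD1 (Ordinal lt)) //= coefZ coefXn eqxx mulr1 big1 ?addr0 //.
  move=> t; rewrite -val_eqE /= coefZ coefXn => /negbTE ->.
  by rewrite !mulr0.
rewrite sum_chi_weight /L; case: ifP => _; last first.
  by apply: big1 => t _; rewrite coef0 mulr0.
rewrite /kraw mulr_sumr; apply: eq_bigr => t _.
by rewrite coefZ mulrCA.
Qed.

Lemma sum_weight (S : {set 'I_M}) (G : nat -> R) :
  \sum_x G (weight S x) =
  2 ^+ (M - #|S|) * \sum_(t < #|S|.+1) 'C(#|S|, t)%:R * G t.
Proof.
have := fourier_weight S finset.set0 G; rewrite finset.sub0set cards0 /fourier /kraw.
under eq_bigr => x _ do rewrite /chi finset.big_set0 mulr1.
move=> ->; congr (_ * _); apply: eq_bigr => t _.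
rewrite expr0 mul1r subn0 mulrC; congr (_ * _).
rewrite exprDn_comm; last by apply: commr_sym; exact: commr1.
under eq_bigr => i _ do rewrite expr1n mul1r.
rewrite coef_sum (bigD1 t) //= coefMn coefXn eqxx big1 ?addr0 //.
  move=> i; rewrite -val_eqE /= coefMn coefXn eq_sym => /negbTE ->.
  by rewrite mul0rn.
Qed.

(** Factor by factor, (r - l) / (m - l) <= r / m. *)
Lemma bin_mul_expn_le r m j :
  (r <= m)%N -> ('C(r, j) * m ^ j <= 'C(m, j) * r ^ j)%N.
Proof.
move=> rm; rewrite -(leq_pmul2r (fact_gt0 j)) mulnAC bin_ffact.
rewrite [leqRHS]mulnAC bin_ffact.
elim: j => [|j IH]; first by rewrite !ffactn0.
rewrite !ffactnSr !expnSr.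
rewrite mulnACA [leqRHS]mulnACA leq_mul //.
by rewrite !mulnBl [(r * m)%N]mulnC leq_sub2l // leq_mul2l rm orbT.
Qed.

Lemma bin_ratio_le k r m j : (r <= m)%N -> (0 < m)%N -> (k <= j)%N ->
  'C(r, j)%:R <= (r%:R / m%:R) ^+ k * 'C(m, j)%:R :> R.
Proof.
move=> rm m0 kj.
have m0R : (0 : R) < m%:R by rewrite ltr0n.
have q01 : 0 <= (r%:R / m%:R : R) <= 1.
  by rewrite divr_ge0 //= ler_pdivrMr // mul1r ler_nat.
have le1 : 'C(r, j)%:R <= (r%:R / m%:R) ^+ j * 'C(m, j)%:R :> R.
  rewrite expr_div_n mulrAC ler_pdivlMr ?exprn_gt0 //.
  by rewrite -!natrX -!natrM ler_nat [leqRHS]mulnC bin_mul_expn_le.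
apply: (le_trans le1); apply: ler_wpM2r => //.
by rewrite ler_wiXn2l //; case/andP: q01.
Qed.

Lemma sum_subset_card (A : {set 'I_M}) (c : nat -> R) :
  \sum_(W : {set 'I_M} | W \subset A) c #|W| =
  \sum_(j < M.+1) 'C(#|A|, j)%:R * c j.
Proof.
have lt (W : {set 'I_M}) : (#|W| < M.+1)%N.
  by rewrite ltnS -[leqRHS](card_ord M) max_card.
rewrite (partition_big (fun W => Ordinal (lt W)) xpredT) //=.
apply: eq_bigr => j _; rewrite -cards_draws -sum1_card natr_sum mulr_suml.
rewrite [RHS](eq_bigl (fun W : {set 'I_M} =>
    (W \subset A) && (Ordinal (lt W) == j))).
  by apply: eq_bigr => W /andP [_ /eqP <-]; rewrite mul1r.
by move=> W; rewrite inE -val_eqE.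
Qed.

(** In Parseval only the sets W inside both S and T survive, and their coefficients depend on the
    size of W alone. Hence the correlation depends only on the overlap, and all its terms are
    nonnegative. *)
Lemma corr_weightE (m : nat) (F : nat -> R) (S T : {set 'I_M}) :
  #|S| = m -> #|T| = m ->
  \sum_x F (weight S x) * F (weight T x) =
  2 ^- M * \sum_(j < M.+1) 'C(#|S :&: T|, j)%:R * (2 ^+ (M - m) * kraw m F j) ^+ 2.
Proof.
move=> Sm Tm; rewrite -(sum_subset_card _ (fun j => (2 ^+ (M - m) * kraw m F j) ^+ 2)).
apply: (canRL (mulKf _)); first by rewrite expf_neq0 // pnatr_eq0.
rewrite -parseval.
rewrite [RHS]big_mkcond /=; apply: eq_bigr => W _.
rewrite !fourier_weight finset.subsetI Sm Tm.
by do 2!case: ifP => _ //=; rewrite ?mulr0 ?mul0r // expr2.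
Qed.

(** Compare termwise with the case S = T. The levels j <= k vanish, and on each level above k
    passing from m to the overlap r costs at least (r / m)^(k+1). What remains is the squared norm
    of F, at most B^2. *)
Lemma corr_weight (m k : nat) (F : nat -> R) (B : R) (S T : {set 'I_M}) :
  (0 < m)%N -> #|S| = m -> #|T| = m ->
  (forall j, (j <= k)%N -> kraw m F j = 0) ->
  (forall t, (t <= m)%N -> `|F t| <= B) ->
  `|\sum_x F (weight S x) * F (weight T x)| <=
  2 ^+ M * (B ^+ 2 * (#|S :&: T|%:R / m%:R) ^+ k.+1).
Proof.
move=> m0 Sm Tm F0 FB.
have rm : (#|S :&: T| <= m)%N by rewrite -Sm subset_leq_card ?finset.subsetIl.
have inv0 : (0 : R) <= 2 ^- M by rewrite invr_ge0 exprn_ge0.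
rewrite (corr_weightE _ Sm Tm) ger0_norm; last first.
  by apply: mulr_ge0 => //; apply: sumr_ge0 => j _; rewrite mulr_ge0 ?sqr_ge0.
apply: (@le_trans _ _ ((#|S :&: T|%:R / m%:R) ^+ k.+1 *
    \sum_x F (weight S x) * F (weight S x))).
  rewrite (corr_weightE _ Sm Sm) finset.setIid Sm mulrCA ler_wpM2l //.
  rewrite mulr_sumr; apply: ler_sum => j _.
  have [jk|kj] := leqP j k; first by rewrite F0 // mulr0 expr0n !mulr0.
  by rewrite [leRHS]mulrA ler_wpM2r ?sqr_ge0 // bin_ratio_le.
rewrite [leLHS]mulrC [leRHS]mulrA; apply: ler_wpM2r.
  by rewrite exprn_ge0 // divr_ge0.
apply: (@le_trans _ _ (\sum_(x : cube M) B ^+ 2)).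
  apply: ler_sum => x _; rewrite -expr2 -real_normK ?num_real //.
  rewrite lerXn2r ?nnegrE //; last by apply: FB; rewrite -Sm weight_le.
  by apply: (le_trans (normr_ge0 (F 0%N))); apply: FB.
by rewrite sumr_const card_ffun card_bool card_ord -[leLHS]mulr_natl natrX.
Qed.

(** Substituting 1 - X = (1 + X) - 2 X expands the polynomial of [kraw] in the X^i (1 + X)^(m - i)
    with i <= j. The coefficient of the latter at t is C(m - i, t - i) = C(m, t) C(t, i) / C(m, i),
    so only the moments against C(t, i) enter. *)
Lemma kraw_eq0 (m k : nat) (F : nat -> R) : (k <= m)%N ->
  (forall i, (i <= k)%N ->
     \sum_(t < m.+1) F t * 'C(m, t)%:R * 'C(t, i)%:R = 0) ->
  forall j, (j <= k)%N -> kraw m F j = 0.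
Proof.
move=> km F0 j jk; have jm := leq_trans jk km.
pose c i : R := (- 2) ^+ i * 'C(j, i)%:R.
have E : (1 - 'X) ^+ j * (1 + 'X) ^+ (m - j) =
    \sum_(i < j.+1) c i *: ('X^i * (1 + 'X) ^+ (m - i)) :> {poly R}.
  have -> : 1 - 'X = (1 + 'X) - 2%:P * 'X :> {poly R} by ring.
  rewrite exprDn mulr_suml; apply: eq_bigr => i _.
  rewrite -mulNr -polyCN exprMn -polyC_exp -mul_polyC /c.
  have -> : (m - i = (j - i) + (m - j))%N by have := ltn_ord i; lia.
  by rewrite exprD polyCM -[X in _ *+ X]/('C(j, i) : nat) -mulr_natr polyC_natr; ring.
have coefE i t : (i <= j)%N -> (t <= m)%N ->
    ('X^i * (1 + 'X) ^+ (m - i) : {poly R})`_t * 'C(m, i)%:R =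
    'C(m, t)%:R * 'C(t, i)%:R.
  move=> ij tm; rewrite coefXnM; case: ltnP => it.
    by rewrite mul0r [X in _ * X%:R]bin_small // mulr0.
  have -> : ((1 + 'X) ^+ (m - i) : {poly R})`_(t - i) = 'C(m - i, t - i)%:R.
    rewrite exprDn_comm; last by apply: commr_sym; exact: commr1.
    have lt : (t - i < (m - i).+1)%N by lia.
    under eq_bigr => l _ do rewrite expr1n mul1r.
    rewrite coef_sum (bigD1 (Ordinal lt)) //= coefMn coefXn eqxx big1 ?addr0 //.
    move=> l; rewrite -val_eqE /= coefMn coefXn eq_sym => /negbTE ->.
    by rewrite mul0rn.
  rewrite -!natrM; congr (_%:R).
  have im := leq_trans it tm.
  apply/eqP; rewrite -(eqn_pmul2r (fact_gt0 i)) -(eqn_pmul2r (fact_gt0 (t - i))).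
  rewrite -(eqn_pmul2r (fact_gt0 (m - t))); apply/eqP.
  transitivity (m`!).
    rewrite -(bin_fact im) -(@bin_fact (m - i) (t - i)); last by lia.
    have -> : (m - i - (t - i) = m - t)%N by lia.
    by ring.
  by rewrite -(bin_fact tm) -(bin_fact it); ring.
rewrite /kraw E.
under eq_bigr => t _ do rewrite coef_sum mulr_sumr.
rewrite exchange_big /= big1 // => i _.
have ij : (i <= j)%N by rewrite -ltnS.
have ci0 : 'C(m, i)%:R != 0 :> R.
  by rewrite pnatr_eq0 -lt0n bin_gt0 (leq_trans ij).
apply: (mulIf ci0); rewrite mul0r mulr_suml.
transitivity (c i * \sum_(t < m.+1) F t * 'C(m, t)%:R * 'C(t, i)%:R); last first.
  by rewrite F0 ?mulr0 // (leq_trans ij jk).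
rewrite mulr_sumr.
apply: eq_bigr => t _; rewrite coefZ.
rewrite -[LHS]mulrA -[X in _ * X]mulrA (coefE _ _ ij); last by rewrite -ltnS.
by ring.
Qed.

End Fourier.

(** * Extrapolation and the level function *)

Section Extrapolation.
Variable R : realFieldType.

Lemma natr_ffact (n i : nat) :
  (n ^_ i)%:R = \prod_(l < i) (n%:R - l%:R) :> R.
Proof.
elim: i => [|i IH]; first by rewrite ffactn0 big_ord0.
rewrite ffactnSr big_ord_recr /= -IH natrM.
have [ni|in_] := ltnP n i; first by rewrite ffact_small // !mul0r.
by rewrite natrB.
Qed.

(** Makes a moment, seen as a function of the length h of a shift, accessible to polynomial
    extrapolation. *)
Lemma bin_shift_poly (s i : nat) : exists p : {poly R},
  (size p <= i.+1)%N /\ forall h : nat, p.[h%:R] = 'C(s + h, i)%:R.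
Proof.
exists (i`!%:R^-1 *: \prod_(l < i) ('X - (l%:R - s%:R)%:P)); split.
  apply: (leq_trans (size_scale_leq _ _)).
  by rewrite size_prod_XsubC -[index_enum _]enumT size_enum_ord.
move=> h; rewrite hornerZ horner_prod.
have f0 : i`!%:R != 0 :> R by rewrite pnatr_eq0 -lt0n fact_gt0.
apply: (mulfI f0); rewrite mulVKf // -natrM mulnC bin_ffact natr_ffact.
by apply: eq_bigr => l _; rewrite !hornerE natrD; ring.
Qed.

(** For nodes i^2 H this bounds the modulus of the Lagrange factor (1 - x_i) / (x_J - x_i), and it
    equals the modulus of the factor for evaluation at 0. *)
Definition sq_ratio (J i : nat) : R := i%:R ^+ 2 / `|J%:R ^+ 2 - i%:R ^+ 2|.

Lemma prod_sq_ratio_lt (J n : nat) : (n < J)%N ->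
  (\prod_(i < n | i.+1 != J) sq_ratio J i.+1) * (J + n)`!%:R =
  n`!%:R ^+ 2 * (J.-1 - n)`!%:R * J%:R.
Proof.
elim: n => [|n IH] nJ.
  by rewrite big_ord0 addn0 fact0 subn0 expr1n !mul1r -natrM mulnC; case: J nJ.
rewrite big_mkcond big_ord_recr -big_mkcond /= ltn_eqF //.
rewrite addnS factS natrM.
have -> : \prod_(i < n | i.+1 != J) sq_ratio J i.+1 * sq_ratio J n.+1 *
  ((J + n).+1%:R * (J + n)`!%:R) =
  (\prod_(i < n | i.+1 != J) sq_ratio J i.+1 * (J + n)`!%:R) *
   (sq_ratio J n.+1 * (J + n).+1%:R) by ring.
rewrite IH; last exact: ltnW.
have -> : (J.-1 - n)%N = (J.-1 - n.+1).+1 by lia.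
rewrite !factS !natrM /sq_ratio.
have -> : (J.-1 - n.+1).+1%:R = J%:R - n.+1%:R :> R.
  by rewrite -natrB; [congr (_%:R); lia | lia].
have -> : (J + n).+1%:R = J%:R + n.+1%:R :> R by rewrite -natrD addnS.
have d0 : 0 < J%:R - n.+1%:R :> R by rewrite subr_gt0 ltr_nat.
have s0 : 0 < J%:R + n.+1%:R :> R by rewrite -natrD ltr0n addnS.
rewrite subr_sqr gtr0_norm ?mulr_gt0 //.
by field; rewrite !nat1r !gt_eqF.
Qed.

(** The induction starts at n = J. There the factor of index J is skipped, and [prod_sq_ratio_lt]
    supplies the product of the J - 1 factors before it. *)
Lemma prod_sq_ratio_ge (J n : nat) : (0 < J <= n)%N ->
  (\prod_(i < n | i.+1 != J) sq_ratio J i.+1) * ((n - J)`! * (n + J)`!)%:R =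
  2 * n`!%:R ^+ 2.
Proof.
case/andP=> J0 Jn; rewrite -(subnK Jn); move: (n - J)%N => {n Jn} d.
rewrite addnK; elim: d => [|d IH].
  case: J J0 => // J _; rewrite add0n big_mkcond big_ord_recr -big_mkcond /=.
  rewrite eqxx mulr1 fact0 mul1n.
  have := @prod_sq_ratio_lt J.+1 J (leqnn _).
  rewrite subnn fact0 mulr1 => E.
  rewrite addnS factS natrM mulrCA E factS natrM -addnS -natr1 natrD -!natr1.
  by ring.
rewrite addSn big_mkcond big_ord_recr -big_mkcond /=.
have -> : ((d + J).+1 != J) by apply/eqP; lia.
rewrite addSn !factS !natrM.
have -> : \prod_(i < d + J | i.+1 != J) sq_ratio J i.+1 * sq_ratio J (d + J).+1 *
  (d.+1%:R * d`!%:R * ((d + J + J).+1%:R * (d + J + J)`!%:R)) =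
  (\prod_(i < d + J | i.+1 != J) sq_ratio J i.+1 * (d`! * (d + J + J)`!)%:R) *
  (sq_ratio J (d + J).+1 * (d.+1%:R * (d + J + J).+1%:R)).
  by rewrite natrM; ring.
rewrite IH /sq_ratio.
have -> : d.+1%:R = (d + J).+1%:R - J%:R :> R.
  by rewrite -natrB; [congr (_%:R); lia | lia].
have -> : (d + J + J).+1%:R = (d + J).+1%:R + J%:R :> R by rewrite -natrD.
have d0 : 0 < (d + J).+1%:R - J%:R :> R by rewrite subr_gt0 ltr_nat; lia.
have s0 : 0 < (d + J).+1%:R + J%:R :> R by rewrite -natrD ltr0n.
rewrite distrC subr_sqr gtr0_norm ?mulr_gt0 //.
move: ((d + J).+1%:R : R) d0 s0 => u d0 s0.
by field; rewrite !gt_eqF.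
Qed.

Lemma sqr_fact_le (n J : nat) : (J <= n)%N -> (n`! ^ 2 <= (n - J)`! * (n + J)`!)%N.
Proof.
elim: J => [|J IH] Jn; first by rewrite subn0 addn0 mulnn.
apply: (leq_trans (IH (ltnW Jn))).
have -> : (n - J = (n - J.+1).+1)%N by lia.
rewrite addnS !factS [X in (X * _ <= _)%N]mulnC -mulnA leq_mul2l.
by apply/orP; right; rewrite leq_mul2r; apply/orP; right; lia.
Qed.

Lemma prod_sq_ratio_le2 (J n : nat) : (0 < J <= n)%N ->
  \prod_(i < n | i.+1 != J) sq_ratio J i.+1 <= 2.
Proof.
move=> Jn; have := prod_sq_ratio_ge Jn.
have p0 : (0 : R) < ((n - J)`! * (n + J)`!)%:R by rewrite ltr0n muln_gt0 !fact_gt0.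
move=> E; rewrite -(ler_pM2r p0) E ler_wpM2l // -natrX ler_nat.
by apply: sqr_fact_le; case/andP: Jn.
Qed.

Lemma sum_inv_sqr_le2 n : \sum_(j < n) (j.+1%:R ^+ 2)^-1 <= 2 :> R.
Proof.
(* The sharper bound telescopes. At n = 0 it uses the convention that the inverse of 0 is 0, so the
   step from 0 to 1 is treated apart. *)
suff : \sum_(j < n) (j.+1%:R ^+ 2)^-1 <= 2 - (n%:R)^-1 :> R.
  by move=> h; apply: (le_trans h); rewrite gerBl invr_ge0.
elim: n => [|n IH]; first by rewrite big_ord0 invr0 subr0.
rewrite big_ord_recr /=; case: n IH => [|n] IH.
  by rewrite big_ord0 expr1n invr1; lra.
apply: (le_trans (lerD IH (lexx _))).
have a0 : (0 : R) < n.+1%:R by [].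
have -> : n.+2%:R = n.+1%:R + 1 :> R by rewrite -natr1.
move: (n.+1%:R : R) a0 => a a0.
have b0 : 0 < a + 1 by lra.
rewrite -subr_ge0.
have -> : 2 - (a + 1)^-1 - (2 - a^-1 + ((a + 1) ^+ 2)^-1) =
  (a * (a + 1) ^+ 2)^-1 by field; rewrite !gt_eqF.
by rewrite invr_ge0 mulr_ge0 ?sqr_ge0 // ltW.
Qed.

(* Lagrange interpolation at the nodes j^2 H, evaluated at 1.  The quadratic
   spacing keeps the weights bounded by 4 / H, uniformly in k. *)
Lemma extrapolation_weights (k H : nat) : (0 < H)%N ->
  exists e : nat -> R,
    (forall p : {poly R}, (size p <= k.+1)%N ->
       p.[1] - p.[0] =
       \sum_(j < k) e j * (p.[(j.+1 ^ 2 * H)%:R] - p.[0])) /\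
    \sum_(j < k) `|e j| <= 4 / H%:R.
Proof.
move=> H0; pose x (j : nat) : R := (j ^ 2 * H)%:R.
have H0R : (0 : R) < H%:R by rewrite ltr0n.
have xinj : injective x.
  move=> i j /eqP; rewrite /x eqr_nat eqn_pmul2r // eqn_exp2r // => /eqP //.
pose l (j : nat) : R := \prod_(i < k.+1 | i != j :> nat) ((1 - x i) / (x j - x i)).
exists (fun j => l j.+1); split.
  have gen (p : {poly R}) : (size p <= k.+1)%N ->
      p.[1] = \sum_(i < k.+1) l i * p.[x i].
    move=> /(lagrange_gen (ltn0Sn k) xinj) {1} ->.
    rewrite horner_sum; apply: eq_bigr => i _.
    rewrite lagrangeE //= 2!hornerM !hornerC [LHS]mulrC; congr (_ * _).
    rewrite !horner_prod -prodfV -big_split /=; apply: eq_bigr => j _.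
    by rewrite !hornerE mulrC.
  move=> p sp.
  (* The weights sum to 1, so p(0) can be subtracted inside the sum; the node 0 then drops out. *)
  have one : 1 = \sum_(i < k.+1) l i.
    have := gen 1%:P; rewrite hornerC => -> //.
      by apply: eq_bigr => i _; rewrite hornerC mulr1.
    by rewrite (leq_trans (size_polyC_leq1 _)).
  rewrite (gen _ sp) -[X in _ - X]mul1r [X in X * p.[0]]one mulr_suml -sumrB.
  rewrite big_ord_recl [l _ * _ - _](_ : _ = 0) ?add0r; last first.
    by rewrite /x /= exp0n // mul0n subrr.
  by apply: eq_bigr => j _; rewrite -mulrBr.
(* The factor of the node 0 has modulus 1 / (H J^2) with J = j + 1, which makes the weights
   summable. The other factors are dominated by [sq_ratio], because |1 - i^2 H| <= i^2 H. *)
have le j : (j < k)%N -> `|l j.+1| <= 2 / H%:R * (j.+1%:R ^+ 2)^-1.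
  move=> jk; rewrite /l normr_prod big_mkcond big_ord_recl -big_mkcond /=.
  have J0 : (0 : R) < j.+1%:R ^+ 2 by rewrite exprn_gt0.
  have -> : `|(1 - x 0) / (x j.+1 - x 0)| = (H%:R)^-1 * (j.+1%:R ^+ 2)^-1.
    rewrite /x exp0n // mul0n !subr0 mul1r natrM natrX ger0_norm.
      by rewrite invfM mulrC.
    by rewrite invr_ge0 mulr_ge0 // ltW.
  rewrite mulrC -mulrA ler_wpM2r ?mulr_ge0 ?invr_ge0 ?sqr_ge0 //.
  apply: (le_trans _ (@prod_sq_ratio_le2 j.+1 k _)) => //.
  apply: ler_prod => i _; rewrite normr_ge0 /= normf_div /sq_ratio /x.
  have -> : bump 0 i = i.+1 by [].
  rewrite !(natrM _ (_ ^ 2)%N H) !(natrX _ _ 2) -mulrBl normrM (ger0_norm (ltW H0R)).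
  rewrite invfM [leLHS]mulrCA [leRHS]mulrC; apply: ler_wpM2l; rewrite ?invr_ge0 //.
  have h1 : (1 : R) <= H%:R by rewrite ler1n.
  have i1 : (1 : R) <= i.+1%:R ^+ 2 by rewrite exprn_ege1 // ler1n.
  rewrite ler_pdivrMr // ler_norml; apply/andP; split; nra.
apply: (@le_trans _ _ (\sum_(j < k) 2 / H%:R * (j.+1%:R ^+ 2)^-1)).
  by apply: ler_sum => j _; apply: le.
rewrite -mulr_sumr mulrC.
apply: (le_trans (ler_wpM2r _ (sum_inv_sqr_le2 k))).
  by rewrite divr_ge0 // ltW.
by rewrite mulrA -natrM.
Qed.

End Extrapolation.

(** * Summation by parts against binomial weights *)

Section Shift.
Variable R : realFieldType.
Implicit Types (f q : nat -> R).

Definition shift (h : nat) f (t : nat) : R := if (h <= t)%N then f (t - h)%N else 0.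

(** Moves a shift from f onto the test function q. The hypothesis ensures that no mass of f is
    pushed beyond m. *)
Lemma sum_shift (m h : nat) f q :
  (forall s, (m < s + h)%N -> f s = 0) ->
  \sum_(t < m.+1) shift h f t * q t = \sum_(s < m.+1) f s * q (s + h)%N.
Proof.
move=> f0.
rewrite -(big_mkord xpredT (fun t => shift h f t * q t)).
rewrite -(big_mkord xpredT (fun s => f s * q (s + h)%N)).
have [hm|mh] := leqP h m.+1; last first.
  rewrite !big1_seq // => i; rewrite mem_index_iota /= => im.
    by rewrite f0 ?mul0r //; lia.
  by rewrite /shift ifN ?mul0r //; lia.
rewrite (@big_cat_nat _ _ _ h) //= big1_seq ?add0r; last first.
  move=> i; rewrite mem_index_iota /= => im; rewrite /shift ifN ?mul0r //; lia.
have := big_addn 0 m.+1 h xpredT (fun t => shift h f t * q t).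
rewrite add0n => ->.
rewrite [RHS](@big_cat_nat _ _ _ (m.+1 - h)) ?leq_subr //=.
rewrite [X in _ = _ + X]big1_seq ?addr0; last first.
  by move=> i; rewrite mem_index_iota /= => im; rewrite f0 ?mul0r //; lia.
by apply: eq_bigr => s _; rewrite /shift leq_addl addnK.
Qed.

Lemma sum_shift_le (m h : nat) f : (forall s, 0 <= f s) ->
  (forall s, (m < s + h)%N -> f s = 0) ->
  \sum_(t < m.+1) shift h f t = \sum_(s < m.+1) f s.
Proof.
move=> f0 fs; have := sum_shift (fun=> 1) fs.
by under eq_bigr do rewrite mulr1; under [in RHS]eq_bigr do rewrite mulr1.
Qed.

Lemma sum_bin_succ n : \sum_(s < n.+2) 'C(n, s)%:R = 2 ^+ n :> R.
Proof.
rewrite big_ord_recr /= bin_small // addr0 -natr_sum.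
rewrite -natrX; congr (_%:R); rewrite -[2%N]/((1 + 1)%N) expnDn.
by apply: eq_bigr => i _; rewrite !exp1n !muln1.
Qed.

(** With m = n + 1, subtract (m - t) C(m, t) = m C(n, t) from t C(m, t) = m C(n, t - 1). *)
Lemma shift_bin_sub n t : (t <= n.+1)%N ->
  'C(n.+1, t)%:R * (2 * t%:R - n.+1%:R) =
  n.+1%:R * (shift 1 (fun s => 'C(n, s)%:R) t - 'C(n, t)%:R) :> R.
Proof.
case: t => [_|t tn].
  by rewrite /shift /= !bin0; ring.
rewrite /shift /= subSS subn0.
have /(congr1 (GRing.natmul (1 : R))) E1 := mul_bin_diag n.+1 t.
have /(congr1 (GRing.natmul (1 : R))) E2 := mul_bin_down n.+1 t.+1.
rewrite /= !natrM in E1 E2; rewrite natrB // in E2.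
rewrite [RHS]mulrBr E1 E2; ring.
Qed.

(** One factor 2t - m becomes a difference of shifts, which is moved onto the other factor, whose
    increment is 2. *)
Lemma bin_second_moment n :
  \sum_(t < n.+2) 'C(n.+1, t)%:R * (2 * t%:R - n.+1%:R) ^+ 2 =
  n.+1%:R * 2 ^+ n.+1 :> R.
Proof.
under eq_bigr => t _.
  rewrite expr2 mulrA shift_bin_sub; last by rewrite -ltnS.
  rewrite -mulrA mulrBl; over.
rewrite -mulr_sumr sumrB (sum_shift (fun t => 2 * t%:R - n.+1%:R)); last first.
  by move=> s; rewrite addn1 ltnS => ns; rewrite bin_small.
rewrite -sumrB; congr (_ * _).
under eq_bigr => t _.
  have -> : 'C(n, t)%:R * (2 * (t + 1)%:R - n.+1%:R) -
     'C(n, t)%:R * (2 * t%:R - n.+1%:R) = 2 * 'C(n, t)%:R :> R.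
    by rewrite natrD; ring.
  over.
by rewrite -mulr_sumr sum_bin_succ exprS.
Qed.

Lemma bin_shift_ratio (m s h : nat) (r : R) : 0 <= r ->
  (forall i, (s <= i < s + h)%N -> i.+1%:R <= r * (m - i)%:R) ->
  'C(m, s)%:R <= r ^+ h * 'C(m, s + h)%:R.
Proof.
move=> r0; elim: h => [|h IH] rH; first by rewrite expr0 mul1r addn0.
apply: (le_trans (IH _)) => [i ih|]; first by apply: rH; lia.
rewrite exprSr -mulrA ler_wpM2l ?exprn_ge0 // addnS.
rewrite -(ler_pM2l (ltr0Sn R (s + h))).
have -> : (s + h).+1%:R * (r * 'C(m, (s + h).+1)%:R) =
   r * (m - (s + h))%:R * 'C(m, s + h)%:R :> R.
  by rewrite mulrCA -natrM mul_bin_left natrM mulrA.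
by rewrite ler_wpM2r // rH //; lia.
Qed.

End Shift.

(** * A bounded function close to X and orthogonal to low degrees *)

Section LevelFunction.
Variables (R : realFieldType) (n k H K : nat) (D : R).
Local Notation m := n.+1.
Hypotheses (k0 : (0 < k)%N) (H0 : (0 < H)%N) (KE : K = (k ^ 2 * H)%N).
Hypotheses (Km : (16 * K <= m)%N) (D0 : 0 < D) (DE : D ^+ 2 = m%:R).

Let K0 : (0 < K)%N. Proof. by rewrite KE muln_gt0 expn_gt0 k0. Qed.
Let K0R : (0 : R) < K%:R. Proof. by rewrite ltr0n. Qed.
(* As C(m,t) (2t - m) / m = c (t - 1) - c t, the function X is a discrete
   derivative of c.  Cutting c off to Psi localises it to |2t - m| <= 2K, and
   subtracting the extrapolated differences of Psi at the nodes j^2 H kills the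
   moments of degree at most k. *)
Let c (s : nat) : R := 'C(n, s)%:R.
Let dev (t : nat) : R := `|2 * t%:R - m%:R| / (2 * K%:R).
Let g (t : nat) : R := Num.min 1 (dev t).
Let Psi (t : nat) : R := c t * (1 - g t).

Let dev_ge0 t : 0 <= dev t.
Proof. by rewrite divr_ge0 // mulr_ge0 // ltW. Qed.

Let g01 t : 0 <= g t <= 1.
Proof. by rewrite /g le_min ler01 dev_ge0 /= ge_min lexx. Qed.

Let Psi_ge0 t : 0 <= Psi t.
Proof. by rewrite mulr_ge0 // subr_ge0; case/andP: (g01 t). Qed.

Let Psi_le t : Psi t <= c t.
Proof. by rewrite ler_piMr // gerBl; case/andP: (g01 t). Qed.

Let g_eq1 t : 2 * K%:R <= `|2 * t%:R - m%:R| :> R -> g t = 1.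
Proof.
by move=> h; rewrite /g; apply/min_idPl; rewrite /dev ler_pdivlMr ?mul1r // mulr_gt0.
Qed.

Let Psi_supp s : Psi s != 0 -> (2 * s < m + 2 * K)%N /\ (m < 2 * s + 2 * K)%N.
Proof.
move=> nz; have : `|2 * s%:R - m%:R| < 2 * K%:R :> R.
  rewrite ltNge; apply: contra nz => /g_eq1 gs.
  by rewrite /Psi gs subrr mulr0.
rewrite ltr_norml => /andP[h1 h2].
split; rewrite -(ltr_nat R) natrD !natrM; lra.
Qed.

Let Psi_shift0 h s : (h <= K)%N -> (m < s + h)%N -> Psi s = 0.
Proof.
by move=> hK ms; apply/eqP; apply: contraT => /Psi_supp; lia.
Qed.

Let gL s : `|g s - g s.+1| <= K%:R^-1.
Proof.
have dL : `|dev s - dev s.+1| <= K%:R^-1.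
  rewrite /dev -mulrBl normrM normfV (ger0_norm (mulr_ge0 _ (ltW K0R))) //.
  rewrite invfM mulrA ler_piMl ?invr_ge0 ?(ltW K0R) //.
  rewrite ler_pdivrMr // mul1r (le_trans (ler_dist_dist _ _)) //.
  by rewrite -natr1 ler_norml; apply/andP; split; lra.
apply: le_trans dL; rewrite /g.
case: (leP 1 (dev s)) => h1; case: (leP 1 (dev s.+1)) => h2.
- by rewrite subrr normr0.
- by rewrite !ger0_norm; lra.
- by rewrite [leLHS]distrC [leRHS]distrC !ger0_norm; lra.
- by [].
Qed.

Lemma level_function_exists : exists F : nat -> R,
  [/\ forall i, (i <= k)%N ->
        \sum_(t < m.+1) F t * 'C(m, t)%:R * 'C(t, i)%:R = 0,
      \sum_(t < m.+1) 'C(m, t)%:R * `|F t - (2 * t%:R - m%:R) / D| <=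
        2 ^+ m * (5 * D / H%:R)
    & forall t, (t <= m)%N -> `|F t| <=
        2 * K%:R / D + D / K%:R + 8 * D / H%:R * (1 + 14 * K%:R / m%:R) ^+ K].
Proof.
have [e [ep es]] := extrapolation_weights R k H0.
pose h (j : nat) := (j.+1 ^ 2 * H)%N.
have hK j : (j < k)%N -> (h j <= K)%N.
  by move=> jk; rewrite KE leq_mul2r leq_exp2r // jk orbT.
pose E t := \sum_(j < k) e j * (shift (h j) Psi t - Psi t).
pose U t := shift 1 Psi t - Psi t - E t.
have Cn0 t : (t <= m)%N -> (0 : R) < 'C(m, t)%:R by move=> tm; rewrite ltr0n bin_gt0.
(* Division by C(m, t) turns masses into values. The factor D is right because D^2 = m gives C(m, t)
   (2t - m) / D = D (c (t - 1) - c t). *)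
exists (fun t => D * U t / 'C(m, t)%:R); split.
- move=> i ik.
  transitivity (D * \sum_(t < m.+1) U t * 'C(t, i)%:R).
    rewrite mulr_sumr; apply: eq_bigr => t _.
    have tm : (t <= m)%N by rewrite -ltnS.
    by rewrite divfK ?gt_eqF ?Cn0 // mulrA.
  apply/eqP; rewrite mulf_eq0 gt_eqF //=; apply/eqP.
  transitivity (\sum_(s < m.+1) Psi s * ('C(s + 1, i)%:R - 'C(s, i)%:R -
      \sum_(j < k) e j * ('C(s + h j, i)%:R - 'C(s, i)%:R))).
    rewrite /U /E.
    under eq_bigr => t _ do rewrite 2!mulrBl mulr_suml.
    rewrite 2!sumrB (sum_shift (fun t => 'C(t, i)%:R));
      last by move=> s; apply: Psi_shift0.
    rewrite -sumrB exchange_big /=.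
    under [in RHS]eq_bigr => s _ do rewrite mulrBr mulrBr mulr_sumr.
    rewrite [RHS]sumrB; congr (_ - _).
    rewrite [RHS]exchange_big /=; apply: eq_bigr => j _.
    under eq_bigr => t _ do rewrite -mulrA mulrBl.
    rewrite -mulr_sumr sumrB (sum_shift (fun t => 'C(t, i)%:R)); last first.
      by move=> s; apply: Psi_shift0; apply: hK.
    rewrite -sumrB mulr_sumr; apply: eq_bigr => s _.
    by ring.
  (* For fixed s the bracket is p(1) - p(0) minus its extrapolation from the nodes, where p(h) = C(s
     + h, i) has degree i <= k. *)
  apply: big1 => s _.
  have [p [sp pE]] := bin_shift_poly R s i.
  have := ep p (leq_trans sp _); rewrite ltnS => /(_ ik).
  have := pE 0%N; rewrite addn0 => ->.
  have := pE 1%N => ->.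
  under eq_bigr => j _ do rewrite pE.
  by move=> ->; rewrite subrr mulr0.
(* Besides [E], the error is the difference of the removed part c g. The discrete product rule
   splits it into g times the difference of c, with g <= [dev], and the slope 1 / K of g times c.
   The three sums are at most 2^m times 4 / H, 1 / (2K) and 1 / (2K), and H <= K gives the constant
   5. *)
- have step1 (t : 'I_m.+1) :
      'C(m, t)%:R * `|D * U t / 'C(m, t)%:R - (2 * t%:R - m%:R) / D| <=
      D * (`|E t| + (dev t * `|shift 1 c t - c t| + K%:R^-1 * shift 1 c t)).
    have tm : (t <= m)%N by rewrite -ltnS.
    have C0 := Cn0 _ tm.
    rewrite -[X in X * _ <= _](ger0_norm (ltW C0)) -normrM.
    have -> : 'C(m, t)%:R * (D * U t / 'C(m, t)%:R - (2 * t%:R - m%:R) / D) =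
        D * (U t - (shift 1 c t - c t)).
      rewrite mulrBr [X in X - _]mulrC divfK ?gt_eqF // [RHS]mulrBr; congr (_ - _).
      by rewrite mulrA shift_bin_sub // -DE; field; rewrite gt_eqF.
    rewrite normrM (ger0_norm (ltW D0)) ler_pM2l //.
    pose G t := c t * g t.
    have -> : U t - (shift 1 c t - c t) = - (E t + (shift 1 G t - G t)).
      by rewrite /U /G /Psi /shift; case: ifP => _; ring.
    rewrite normrN (le_trans (ler_normD _ _)) // lerD2l /G.
    case: (t : nat) => [|s].
      rewrite /shift /= mulr0 addr0 !sub0r !normrN normrM mulrC.
      rewrite ler_wpM2r // ger0_norm; last by case/andP: (g01 0).
      by rewrite /g ge_min lexx orbT.
    rewrite /shift /= subSS subn0.
    have -> : c s * g s - c s.+1 * g s.+1 =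
      g s.+1 * (c s - c s.+1) + (g s - g s.+1) * c s by ring.
    rewrite (le_trans (ler_normD _ _)) // !normrM lerD //.
      rewrite ler_wpM2r // ger0_norm; last by case/andP: (g01 s.+1).
      by rewrite /g ge_min lexx orbT.
    by rewrite [`|c s|]ger0_norm // ler_wpM2r.
  apply: (le_trans (ler_sum _ (fun t _ => step1 t))).
  rewrite -mulr_sumr !big_split /=.
  have PsiS : \sum_(t < m.+1) Psi t <= 2 ^+ n.
    by rewrite -sum_bin_succ; apply: ler_sum => t _.
  have sE : \sum_(t < m.+1) `|E t| <= 4 / H%:R * 2 ^+ m.
    apply: (@le_trans _ _ (\sum_(t < m.+1) \sum_(j < k) `|e j| * (shift (h j) Psi t + Psi t))).
      apply: ler_sum => t _; apply: (le_trans (ler_norm_sum _ _ _)).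
      apply: ler_sum => j _; rewrite normrM ler_wpM2l //.
      rewrite (le_trans (ler_normB _ _)) // ger0_norm ?(ger0_norm (Psi_ge0 _)) //.
      by rewrite /shift; case: ifP.
    rewrite exchange_big /=.
    apply: (@le_trans _ _ (\sum_(j < k) `|e j| * 2 ^+ m)); last first.
      by rewrite -mulr_suml ler_wpM2r // exprn_ge0.
    apply: ler_sum => j _; rewrite -mulr_sumr ler_wpM2l // big_split /=.
    rewrite sum_shift_le //; last by move=> s; apply: Psi_shift0; apply: hK.
    by rewrite exprS mulr_natl mulr2n lerD.
  have sD : \sum_(t < m.+1) dev t * `|shift 1 c t - c t| = 2 ^+ m / (2 * K%:R).
    have m0 : (0 : R) < m%:R by [].
    transitivity ((2 * K%:R)^-1 * (m%:R^-1 *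
        \sum_(t < m.+1) 'C(m, t)%:R * (2 * t%:R - m%:R) ^+ 2) : R); last first.
      by rewrite bin_second_moment mulKf ?gt_eqF // mulrC.
    rewrite !mulr_sumr; apply: eq_bigr => t _.
    have tm : (t <= m)%N by rewrite -ltnS.
    have -> : shift 1 c t - c t = m%:R^-1 * ('C(m, t)%:R * (2 * t%:R - m%:R)) :> R.
      by rewrite shift_bin_sub // mulKf ?gt_eqF.
    rewrite !normrM ger0_norm ?invr_ge0 // [`|'C(m, t)%:R|]ger0_norm //.
    rewrite -[X in _ = _ * (_ * (_ * X))]real_normK ?num_real // /dev; ring.
  have sC : \sum_(t < m.+1) K%:R^-1 * shift 1 c t = 2 ^+ n / K%:R.
    rewrite -mulr_sumr sum_shift_le ?sum_bin_succ 1?mulrC //.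
    by move=> s; rewrite addn1 ltnS => ns; rewrite /c bin_small.
  rewrite sD sC.
  have HK : (K%:R : R)^-1 <= H%:R^-1.
    by rewrite lef_pV2 ?posrE ?ltr0n // ler_nat KE leq_pmull // expn_gt0 k0.
  have -> : 2 ^+ m / (2 * K%:R) + 2 ^+ n / K%:R = 2 ^+ m * K%:R^-1 :> R.
    by rewrite exprS; field; rewrite gt_eqF.
  have -> : 2 ^+ m * (5 * D / H%:R) = D * (4 / H%:R * 2 ^+ m + 2 ^+ m * H%:R^-1) :> R by ring.
  by rewrite ler_pM2l // lerD // ler_wpM2l // exprn_ge0.
- move=> t tm; have C0 := Cn0 _ tm.
  have m0 : (0 : R) < m%:R by [].
  (* r bounds C(m, l) / C(m, l + 1) as long as l + 1 <= m / 2 + 2K, which covers all positions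
     crossed by a shift of at most K from the support of [Psi]. The constant 14 suffices because 16
     K <= m. *)
  set r := 1 + 14 * K%:R / m%:R.
  have r1 : 1 <= r by rewrite /r lerDl divr_ge0 // mulr_ge0.
  have rK1 : 1 <= r ^+ K by rewrite exprn_ege1.
  have rK0 : 0 <= r ^+ K by apply: le_trans rK1.
  have cC s : c s <= 'C(m, s)%:R.
    by rewrite ler_nat; case: s => [|s]; rewrite ?bin0 // binS leq_addr.
  have shB i : (i <= K)%N -> shift i Psi t <= r ^+ K * 'C(m, t)%:R.
    move=> iK; rewrite /shift; case: ifP => it; last by rewrite mulr_ge0.
    set s := (t - i)%N.
    have [->|/Psi_supp [s1 s2]] := eqVneq (Psi s) 0.
      by rewrite mulr_ge0.
    rewrite (le_trans (Psi_le _)) // (le_trans (cC _)) //.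
    have -> : t = (s + i)%N by rewrite /s subnK.
    apply: (@le_trans _ _ (r ^+ i * 'C(m, s + i)%:R : R)); last first.
      by rewrite ler_wpM2r // ler_weXn2l.
    apply: bin_shift_ratio => [|l /andP [sl li]]; first exact: le_trans r1.
    have lm : (2 * l + 2 <= m + 4 * K)%N by lia.
    have lm' : (l <= m)%N by lia.
    rewrite natrB //.
    have lmR : 2 * l%:R + 2 <= m%:R + 4 * K%:R :> R by rewrite -!natrM -!natrD ler_nat.
    have KmR : 16 * K%:R <= m%:R :> R by rewrite -natrM ler_nat.
    have q1 : 14 * K%:R / m%:R <= 14 / 16 :> R by rewrite ler_pdivrMr //; lra.
    have q2 : (14 * K%:R / m%:R) * m%:R = 14 * K%:R :> R by rewrite divfK ?gt_eqF.
    have q0 : 0 <= 14 * K%:R / m%:R :> R by rewrite divr_ge0 // mulr_ge0.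
    rewrite /r -(natr1 l); move: q0 q1 q2; move: (14 * K%:R / m%:R : R) => q q0 q1 q2.
    apply: (@le_trans _ _ ((1 + q) * (m%:R / 2 - 2 * K%:R))).
      have : q * K%:R <= 14 / 16 * K%:R :> R by rewrite ler_wpM2r.
      have K0' : 0 <= K%:R :> R by [].
      by lra.
    by rewrite ler_wpM2l //; lra.
  have EB : `|E t| <= 8 / H%:R * r ^+ K * 'C(m, t)%:R.
    apply: (@le_trans _ _ (\sum_(j < k) `|e j| * (2 * r ^+ K * 'C(m, t)%:R))).
      apply: (le_trans (ler_norm_sum _ _ _)); apply: ler_sum => j _.
      rewrite normrM ler_wpM2l // (le_trans (ler_normB _ _)) //.
      rewrite [X in X + _]ger0_norm ?(ger0_norm (Psi_ge0 _)); last first.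
        by rewrite /shift; case: ifP.
      rewrite -mulrA mulr_natl mulr2n lerD //; first by apply: shB; apply: hK.
      rewrite (le_trans (Psi_le _)) // (le_trans (cC _)) //.
      by rewrite ler_peMl // ltW.
    rewrite -mulr_suml (le_trans (ler_wpM2r _ es)) //.
      by rewrite !mulr_ge0.
    by rewrite le_eqVlt; apply/orP; left; apply/eqP; ring.
  have PB : `|shift 1 Psi t - Psi t| <= (2 * K%:R / m%:R + K%:R^-1) * 'C(m, t)%:R.
    case: t tm C0 {shB EB} => [|s] tm C0.
      have g0 : g 0 = 1.
        apply: g_eq1; rewrite mulr0 sub0r normrN ger0_norm // -natrM ler_nat.
        by lia.
      rewrite /shift /= sub0r normrN /Psi g0 subrr mulr0 normr0.
      by rewrite mulr_ge0 // addr_ge0 ?invr_ge0 ?divr_ge0 ?mulr_ge0.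
    rewrite /shift /= subSS subn0 /Psi.
    have -> : c s * (1 - g s) - c s.+1 * (1 - g s.+1) =
      (1 - g s.+1) * (c s - c s.+1) + - ((g s - g s.+1) * c s) by ring.
    rewrite (le_trans (ler_normD _ _)) // normrN !normrM mulrDl lerD //; last first.
      rewrite ler_pM // ger0_norm // ler_nat binS leq_addl //.
    have -> : c s - c s.+1 = m%:R^-1 * ('C(m, s.+1)%:R * (2 * s.+1%:R - m%:R)) :> R.
      have := shift_bin_sub R tm; rewrite /shift /= subSS subn0 => ->.
      by rewrite mulKf ?gt_eqF.
    rewrite !normrM ger0_norm ?subr_ge0; last by case/andP: (g01 s.+1).
    rewrite [`|m%:R^-1|]ger0_norm ?invr_ge0 // [`|'C(m, _)%:R|]ger0_norm //.
    (* The cut-off bounds X here: |2t - m| is below 2K wherever 1 - g is nonzero. *)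
    have le : (1 - g s.+1) * `|2 * s.+1%:R - m%:R| <= 2 * K%:R :> R.
      have [/g_eq1 ->|lt] := leP (2 * K%:R : R) `|2 * s.+1%:R - m%:R|.
        by rewrite subrr mul0r mulr_ge0.
      apply: le_trans (ltW lt); rewrite ler_piMl // gerBl.
      by case/andP: (g01 s.+1).
    rewrite (_ : (1 - g s.+1) * _ = (1 - g s.+1) * `|2 * s.+1%:R - m%:R| *
       (m%:R^-1 * 'C(m, s.+1)%:R)); last by ring.
    by rewrite -[leRHS]mulrA; apply: ler_wpM2r; rewrite // mulr_ge0 ?invr_ge0.
  rewrite normrM normfV (ger0_norm (ltW C0)) ler_pdivrMr // normrM (ger0_norm (ltW D0)).
  apply: (@le_trans _ _ (D * ((2 * K%:R / m%:R + K%:R^-1) * 'C(m, t)%:R +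
       8 / H%:R * r ^+ K * 'C(m, t)%:R))).
    by rewrite ler_pM2l // (le_trans (ler_normB _ _)) // lerD.
  rewrite -DE le_eqVlt; apply/orP; left; apply/eqP; field.
  by rewrite !gt_eqF // ltr0n.
Qed.

End LevelFunction.

(** * Overlaps of two sets of size m *)

Lemma card_supersets (M m : nat) (W : {set 'I_M}) :
  (#|[set T : {set 'I_M} | (W \subset T) && (#|T| == m)]| <=
   'C(M - #|W|, m - #|W|))%N.
Proof.
have -> : (M - #|W| = #|~: W|)%N by rewrite [RHS]cardsCs finset.setCK card_ord.
rewrite -cards_draws -(card_in_imset (f := fun T => T :\: W)).
  apply: subset_leq_card; apply/fintype.subsetP => _ /imsetP [T + ->].
  rewrite !inE => /andP [WT /eqP <-]; rewrite finset.subDset finset.setUCr finset.subsetT /=.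
  by rewrite cardsD (finset.setIidPr WT).
move=> T T'; rewrite !inE => /andP [WT _] /andP [WT' _] E.
by rewrite -(finset.setID T W) -(finset.setID T' W) (finset.setIidPr WT) (finset.setIidPr WT') E.
Qed.

(** Union bound over the s-subsets of S that T may contain. *)
Lemma card_large_overlap (M m s : nat) (S : {set 'I_M}) : #|S| = m ->
  (#|[set T : {set 'I_M} | (#|T| == m) && (s <= #|S :&: T|)]| <=
   'C(m, s) * 'C(M - s, m - s))%N.
Proof.
move=> Sm; rewrite -[X in ('C(X, s) * _)%N]Sm -cards_draws -sum_nat_const.
pose X := [set W : {set 'I_M} | W \subset S & #|W| == s].
apply: (@leq_trans (\sum_(T : {set 'I_M} | (#|T| == m) && (s <= #|S :&: T|)%N)
    \sum_(W in X) (W \subset T))).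
  rewrite -sum1dep_card; apply: leq_sum => T /andP [_ sT].
  have := bin_gt0 #|S :&: T| s; rewrite sT -cards_draws => /card_gt0P [W].
  rewrite inE finset.subsetI => /andP [/andP [WS WT] Ws].
  by rewrite (bigD1 W) ?inE ?WS //= WT.
rewrite exchange_big /=; apply: leq_sum => W; rewrite inE => /andP [WS /eqP Ws].
apply: (@leq_trans 'C(M - #|W|, m - #|W|)); last by rewrite Ws.
apply: leq_trans (card_supersets m W).
rewrite -sum1dep_card big_mkcond [leqRHS]big_mkcond /=; apply: leq_sum => T _.
by case: ifP => // /andP [-> _]; case: (W \subset T).
Qed.

(** s^s / s! is one term of the series of exp(s), and e <= 4. The type [R] only hosts this
    argument. *)
Lemma expn_le_fact (R : realType) s : (s ^ s <= 4 ^ s * s`!)%N.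
Proof.
have e4 : expR 1 <= 4 :> R.
  have : (2^-1 : R) <= expR (- 2^-1) by apply: le_trans (expR_ge1Dx _); lra.
  rewrite expRN lef_pV2 ?posrE ?expR_gt0 // => h.
  have -> : (1 : R) = 2^-1 + 2^-1 by lra.
  by rewrite expRD; have := expR_gt0 (2^-1 : R); nra.
case: s => // s; rewrite -(ler_nat R) natrM !natrX.
have f0 : (0 : R) < (s.+1)`!%:R by rewrite ltr0n fact_gt0.
rewrite -ler_pdivrMr //; apply: (@le_trans _ _ (expR s.+1%:R)).
  by apply: le_trans (expR_ge1Dxn s _); rewrite ?lerDr.
rewrite -[X in expR X]mulr1 expRM_natl lerXn2r ?nnegrE //.
Qed.

(** Double counting gives C(m, s) C(M - s, m - s) / C(M, m) = C(m, s)^2 / C(M, s). This is at most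
    C(m, s) (m / M)^s <= (4 m^2 / (s M))^s, and the hypothesis with 8 makes the base at most 1/2. *)
Lemma large_overlap_rare (R : realType) (M m s : nat) :
  (0 < m)%N -> (s <= m)%N -> (m <= M)%N -> (8 * m ^ 2 <= s * M)%N ->
  ('C(m, s) * 'C(M - s, m - s) * 2 ^ s <= 'C(M, m))%N.
Proof.
move=> m0 sm mM big; set X := ('C(m, s) * 'C(M - s, m - s))%N.
have E : ('C(M, m) * 'C(m, s) = 'C(M, s) * 'C(M - s, m - s))%N.
  apply/eqP; rewrite -(eqn_pmul2r (fact_gt0 s)) -(eqn_pmul2r (fact_gt0 (m - s))).
  rewrite -(eqn_pmul2r (fact_gt0 (M - m))); apply/eqP.
  transitivity (M`!).
    by rewrite -(bin_fact mM) -(bin_fact sm); ring.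
  rewrite -(bin_fact (leq_trans sm mM)) -(@bin_fact (M - s) (m - s)); last by lia.
  have -> : (M - s - (m - s) = M - m)%N by lia.
  by ring.
have CMs : (0 < 'C(M, s))%N by rewrite bin_gt0 (leq_trans sm).
have h1 : (X * M ^ s <= m ^ s * 'C(m, s) * 'C(M, m))%N.
  rewrite -(leq_pmul2l CMs).
  have -> : ('C(M, s) * (X * M ^ s) = ('C(m, s) * M ^ s) * ('C(M, m) * 'C(m, s)))%N.
    by rewrite E /X; ring.
  have -> : ('C(M, s) * (m ^ s * 'C(m, s) * 'C(M, m)) =
      ('C(M, s) * m ^ s) * ('C(M, m) * 'C(m, s)))%N by ring.
  by rewrite leq_mul2r bin_mul_expn_le ?orbT.
have h2 : ('C(m, s) * s ^ s <= 4 ^ s * m ^ s)%N.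
  apply: (leq_trans (leq_mul (leqnn _) (expn_le_fact R s))).
  rewrite mulnCA leq_mul2l bin_ffact; apply/orP; right.
  elim: (s) => [|i IH]; first by rewrite ffactn0.
  by rewrite ffactnSr expnSr leq_mul // leq_subr.
have h3 : (X * (s * M) ^ s <= 4 ^ s * (m ^ 2) ^ s * 'C(M, m))%N.
  rewrite expnMn [(s ^ s * _)%N]mulnC mulnA.
  apply: (leq_trans (leq_mul h1 (leqnn _))).
  rewrite -expnM mul2n -addnn expnD.
  have -> : (m ^ s * 'C(m, s) * 'C(M, m) * s ^ s =
     ('C(m, s) * s ^ s) * (m ^ s * 'C(M, m)))%N by ring.
  apply: (leq_trans (leq_mul h2 (leqnn _))).
  by apply/eq_leq; ring.
have p0 : (0 < 4 ^ s * (m ^ 2) ^ s)%N by rewrite muln_gt0 !expn_gt0 m0.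
rewrite -(leq_pmul2l p0); apply: leq_trans h3.
have -> : (4 ^ s * (m ^ 2) ^ s * (X * 2 ^ s) = X * (8 * m ^ 2) ^ s)%N.
  by rewrite expnMn -[8%N]/(4 * 2)%N [((4 * 2) ^ s)%N]expnMn; ring.
rewrite leq_mul2l; apply/orP; right.
by have [-> //|s0] := posnP s; rewrite leq_exp2r.
Qed.

(** * Statistical query algorithms *)

Section Averaging.
Local Open Scope classical_set_scope.

(** Integrate the number of events containing w. If the claim failed everywhere, integrality would
    keep this number at most (|D| - 1) / 3 at each w, so a non-strict comparison of integrals
    already contradicts the mean |D| / 3. *)
Lemma point_in_third (R : realType) (d : measure_display) (T : measurableType d)
    (Pr : probability T R) (I : finType) (D : {set I}) (G : I -> set T) :
  (forall i, measurable (G i)) ->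
  (forall i, i \in D -> ((3^-1)%:E <= Pr (G i))%E) ->
  exists w, (#|D| <= 3 * #|[set i in D | w \in G i]|)%N.
Proof.
move=> mG G3; apply: contrapT => no.
have lt w : (3 * #|[set i in D | w \in G i]| + 1 <= #|D|)%N.
  by rewrite addn1 ltnNge; apply/negP => h; apply: no; exists w.
pose f (i : I) (w : T) : \bar R := (\1_(G i) w)%:E.
have mf i : measurable_fun setT (f i) by apply/measurable_EFinP; exact: measurable_indic.
have f0 i w : setT w -> (0 <= f i w)%E by rewrite /f lee_fin.
have := ge0_integral_sum Pr measurableT mf f0 (enum D).
under eq_bigr => i _ do rewrite /f integral_indic // setIT.
move=> E.
have lo : ((#|D|%:R / 3)%:E <= \sum_(i <- enum D) Pr (G i))%E.
  have -> : ((#|D|%:R / 3 : R)%:E = \sum_(i <- enum D) (3^-1)%:E)%E.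
    by rewrite sumEFin big_enum /= sumr_const mulr_natl.
  rewrite big_enum [leRHS]big_enum /=; exact: lee_sum.
have : (\sum_(i <- enum D) Pr (G i) <= ((#|D|%:R - 1) / 3)%:E)%E.
  rewrite -E.
  have -> : (((#|D|%:R - 1) / 3)%:E =
      \int[Pr]_(x in setT) cst ((#|D|%:R - 1) / 3 : R)%:E x)%E.
    rewrite integral_cst // [X in (_ * X)%E](_ : _ = 1%E) ?mule1 //.
    exact: probability_setT.
  apply: ge0_le_integral => //.
  - by move=> w _; apply: sume_ge0 => i _; apply: f0.
  - by apply: emeasurable_sum.
  move=> w _; rewrite /f sumEFin lee_fin big_enum /=.
  under eq_bigr => i _ do rewrite indicE.
  rewrite -natr_sum -big_mkcondr /= sum1dep_card.
  rewrite ler_pdivlMr // lerBrDr -natrM -(natrD _ _ 1) ler_nat mulnC.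
  exact: lt.
move/(le_trans lo); rewrite lee_fin ler_pM2r ?invr_gt0 //.
by rewrite lerBrDr gerDl ler10.
Qed.

Lemma prob_ge_inter (R : realType) (d : measure_display) (T : measurableType d)
    (Pr : probability T R) (E F : set T) :
  prob_ge Pr E (2 / 3) -> prob_ge Pr F (2 / 3) ->
  prob_ge Pr (E `&` F) 3^-1.
Proof.
move=> [E' [mE E'E PE]] [F' [mF F'F PF]]; exists (E' `&` F'); split.
- exact: measurableI.
- by move=> w [/E'E ? /F'F ?].
have cE : (Pr (~` E') <= (3^-1)%:E)%E.
  rewrite probability_setC // leeBlDr ?fin_num_measure //.
  apply: (@le_trans _ _ ((3^-1)%:E + (2 / 3)%:E)%E); last exact: leeD2l.
  by rewrite -EFinD lee_fin; lra.
have := measureDI Pr mF mE; rewrite setIC => PFE.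
have d3 : (Pr (F' `\` E') <= (3^-1)%:E)%E.
  by apply: le_trans cE; rewrite setDE measureIr //; exact: measurableC.
have : ((2 / 3)%:E <= (3^-1)%:E + Pr (E' `&` F'))%E.
  by apply: (le_trans PF); rewrite PFE; exact: leeD2r.
rewrite -leeBlDl // -EFinB; apply: le_trans.
by rewrite lee_fin; lra.
Qed.

End Averaging.

Section Runs.
Variables (R : realType) (M : nat).

Definition exact_oracle (D : cube M -> R) : oracle R M := fun _ f => expect D f.

Lemma exact_oracle_stat D : stat_oracle D (exact_oracle D).
Proof. by move=> h f; rewrite /exact_oracle subrr normr0 ltW // query_tol_gt0. Qed.

Definition separates (U D : cube M -> R) (f : query R M) : bool :=
  query_tol f < `|expect U f - expect D f|.

(* A legal oracle for D that imitates the exact oracle for U on every query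
   that does not tell U and D apart. *)
Definition imitating_oracle (U D : cube M -> R) : oracle R M :=
  fun _ f => if separates U D f then expect D f else expect U f.

Lemma imitating_oracle_stat U D : stat_oracle D (imitating_oracle U D).
Proof.
move=> h f; rewrite /imitating_oracle; case: ifPn; last by rewrite -leNgt.
by rewrite subrr normr0 ltW // query_tol_gt0.
Qed.

Lemma has_run (O : oracle R M) (P : pred (query R M * R)) h a :
  has P h -> has P (run O h a).1.
Proof.
elim: a h => [v|f next IH] h //= Ph; apply: IH.
by rewrite has_rcons Ph orbT.
Qed.

(** The oracles can differ only at a separating query, and [has_run] shows that any query asked
    stays in the final transcript. *)
Lemma run_imitating (U D : cube M -> R) h a :
  ~~ has (fun qa => separates U D qa.1) (run (exact_oracle U) h a).1 ->
  run (imitating_oracle U D) h a = run (exact_oracle U) h a.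
Proof.
elim: a h => [v|f next IH] h //= ns.
have fE : imitating_oracle U D h f = exact_oracle U h f.
  rewrite /imitating_oracle ifN //; apply: contra ns => sf.
  by apply: has_run; rewrite has_rcons /= sf.
by rewrite fE IH.
Qed.

Lemma sum_has_le (I : finType) (D : {set I}) (X : Type) (P : I -> pred X)
    (s : seq X) (beta : R) :
  all (fun x => #|[set i in D | P i x]|%:R <= beta) s ->
  #|[set i in D | has (P i) s]|%:R <= (size s)%:R * beta.
Proof.
elim: s => [|x s IH] /=.
  by rewrite (_ : [set i in D | false] = finset.set0)
      ?cards0 ?mul0r //; apply/finset.setP => i; rewrite !inE andbF.
case/andP => hx /IH hs; rewrite -natr1 mulrDl mul1r addrC.
apply: le_trans (lerD hx hs); rewrite -natrD ler_nat.
apply: leq_trans (leq_card_setU _ _); apply: subset_leq_card.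
by apply/fintype.subsetP => i; rewrite !inE -andb_orr.
Qed.

(** For each i, with probability at least 1/3 the same seed is right both for U and for P i with the
    imitating oracle. Some fixed seed therefore serves a third of all i. Its single transcript
    against U must separate each of these from U, while one query separates at most [beta] of
    them. *)
Lemma sq_lower_bound (d : measure_display) (T : measurableType d)
    (Pr : probability T R) (A : T -> sq_alg R M) (H0 H1 : (cube M -> R) -> Prop)
    (U : cube M -> R) (I : finType) (D : {set I}) (P : I -> cube M -> R)
    (t N beta : R) :
  distinguishes Pr A H0 H1 (2 / 3) -> H0 U -> (forall i, i \in D -> H1 (P i)) ->
  (forall f : query R M, t <= query_tol f ->
     #|[set i in D | separates U (P i) f]|%:R <= beta) ->
  0 <= beta -> 3 * (N * beta) < #|D|%:R ->
  makes_query_better_than A H0 H1 t \/ makes_at_least_queries A H0 H1 N.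
Proof.
move=> [A0 A1] HU HP few b0 small.
apply: contrapT => /not_orP [nbetter nmany].
pose O0 := exact_oracle U.
pose O i := imitating_oracle U (P i).
have poss w : possible_transcript A H0 H1 (transcript O0 (A w)).
  by exists U, O0, w; split => //; [left | exact: exact_oracle_stat].
have ex i : exists g : set T, measurable g /\
    (i \in D -> ((3^-1)%:E <= Pr g)%E /\
      (g `<=` [set w | output O0 (A w) = SayH0] `&`
                [set w | output (O i) (A w) = SayH1])%classic).
  have [iD|niD] := boolP (i \in D); last first.
    by exists set0; split => // iD; rewrite iD in niD.
  have [F [mF FS PF]] := prob_ge_inter (A0 _ _ HU (@exact_oracle_stat U))
    (A1 _ _ (HP _ iD) (@imitating_oracle_stat U (P i))).
  by exists F.
have [G GP] := boolp.choice ex.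
have [w hw] := @point_in_third _ _ _ Pr I D G (fun i => (GP i).1)
  (fun i iD => ((GP i).2 iD).1).
set tr := transcript O0 (A w).
have size_tr : (size tr)%:R < N.
  by rewrite ltNge; apply/negP => h; apply: nmany; exists tr; split => //; exact: poss.
(* Without a separating query the two runs would be the same run, yet their outputs are [SayH0] and
   [SayH1]. *)
have le1 : #|[set i in D | w \in G i]|%:R <=
    #|[set i in D | has (fun qa => separates U (P i) qa.1) tr]|%:R :> R.
  rewrite ler_nat; apply: subset_leq_card; apply/fintype.subsetP => i.
  rewrite !inE => /andP [iD wG]; rewrite iD /=; apply: contraT => ns.
  have [_ /(_ iD) [_ sub]] := GP i.
  have /sub [/= o0 o1] : G i w by move: wG; rewrite in_setE.
  by move: o1; rewrite /output run_imitating // -/(output _ _) o0.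
have le2 := @sum_has_le I D _ (fun i qa => separates U (P i) qa.1) tr beta.
have : (#|D|%:R : R) <= 3 * (N * beta).
  apply: (@le_trans _ _ (3 * #|[set i in D | w \in G i]|%:R)).
    by rewrite -natrM ler_nat.
  rewrite ler_pM2l // (le_trans le1) // (le_trans (le2 _)) //; last first.
    by rewrite ler_wpM2r // ltW.
  apply: contraT => nall; exfalso; apply: nbetter; exists tr; split; first exact: poss.
  have sub : has (predC (fun qa => #|[set i in D | separates U (P i) qa.1]|%:R <= beta)) tr.
    by rewrite has_predC.
  apply: sub_has sub => qa /=; apply: contraR; rewrite -leNgt.
  exact: few.
by rewrite leNgt small.
Qed.

End Runs.

(** * Total variation distances and correlations *)

Section TotalVariation.
Variables (R : realType) (M : nat).

Lemma unifE (x : cube M) : unif R x = 2 ^- M.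
Proof. by rewrite /unif card_ffun card_bool card_ord natrX. Qed.

Lemma unif_distr : is_distr (@unif R M).
Proof.
split=> [x|]; first by rewrite unifE invr_ge0 exprn_ge0.
rewrite sumr_const -[LHS]mulr_natr mulVf //.
by rewrite pnatr_eq0 card_ffun card_bool card_ord expn_eq0.
Qed.

(** The density of the biased distribution relative to the uniform one at weight t, with z twice the
    bias; see [biasedE]. *)
Definition tilt (z : R) (m t : nat) : R := (1 + z) ^+ t * (1 - z) ^+ (m - t).

Lemma biasedE (S : {set 'I_M}) (d : R) (x : cube M) :
  biased S d x = 2 ^- M * tilt (2 * d) #|S| (weight S x).
Proof.
transitivity (\prod_(i < M) (2^-1 *
    (if i \in S then if x i then 1 + 2 * d else 1 - 2 * d else 1))).
  apply: eq_bigr => i _; rewrite /coord_mean.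
  by case: (i \in S); case: (x i); rewrite ?mulr1 //; field.
rewrite big_split /= prodr_const card_ord exprVn; congr (_ * _).
rewrite -big_mkcond /=.
have wC : (\sum_(i in S) (~~ x i) = #|S| - weight S x)%N.
  rewrite /weight -sum1_card -(addKn (\sum_(i in S) x i)%N (\sum_(i in S) ~~ x i)%N).
  congr (_ - _)%N; rewrite -big_split /=; apply: eq_bigr => i _.
  by case: (x i).
rewrite /tilt -wC /weight.
rewrite (big_morph _ (exprD (1 + 2 * d)) (expr0 _)).
rewrite (big_morph _ (exprD (1 - 2 * d)) (expr0 _)) -big_split /=.
by apply: eq_bigr => i _; case: (x i); rewrite ?expr1 ?expr0 ?mulr1 ?mul1r.
Qed.

Lemma dTV_weight (S : {set 'I_M}) (a b : nat -> R) (D D' : cube M -> R) :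
  (forall x, D x = 2 ^- M * a (weight S x)) ->
  (forall x, D' x = 2 ^- M * b (weight S x)) ->
  dTV D D' =
  2^-1 * (2 ^- #|S| * \sum_(t < #|S|.+1) 'C(#|S|, t)%:R * `|a t - b t|).
Proof.
move=> DE D'E; rewrite /dTV; congr (_ * _).
have SM : (#|S| <= M)%N by rewrite -[leqRHS](card_ord M) max_card.
transitivity (2 ^- M * \sum_x `|a (weight S x) - b (weight S x)|).
  rewrite mulr_sumr; apply: eq_bigr => x _; rewrite DE D'E -mulrBr normrM.
  by rewrite ger0_norm // invr_ge0 exprn_ge0.
rewrite (sum_weight S (fun t => `|a t - b t|)) mulrA; congr (_ * _).
rewrite -{1}(subnK SM) exprD invfM mulrAC mulVf ?mul1r //.
Qed.

End TotalVariation.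

(** * Second moments of the biased density and of its linear part *)

Section TiltMoments.
Variable R : realType.
Implicit Types z v : R.

Lemma sum_bin_pq (m : nat) (p q : R) :
  \sum_(t < m.+1) 'C(m, t)%:R * (p ^+ t * q ^+ (m - t)) = (p + q) ^+ m.
Proof.
rewrite addrC exprDn; apply: eq_bigr => t _.
by rewrite [q ^+ _ * _]mulrC mulr_natl.
Qed.

Lemma sum_bin_tilt z m : \sum_(t < m.+1) 'C(m, t)%:R * tilt z m t = 2 ^+ m.
Proof. by rewrite sum_bin_pq; congr (_ ^+ _); ring. Qed.

Lemma sum_bin_tilt_sqr z m :
  \sum_(t < m.+1) 'C(m, t)%:R * tilt z m t ^+ 2 = 2 ^+ m * (1 + z ^+ 2) ^+ m.
Proof.
under eq_bigr do rewrite /tilt exprMn -!exprM ![(_ * 2)%N]mulnC !exprM.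
by rewrite sum_bin_pq -exprMn; congr (_ ^+ _); ring.
Qed.

Lemma sum_bin_tilt_lin z n :
  \sum_(t < n.+2) 'C(n.+1, t)%:R * (2 * t%:R - n.+1%:R) * tilt z n.+1 t =
  n.+1%:R * 2 ^+ n.+1 * z.
Proof.
under eq_bigr => t _.
  rewrite shift_bin_sub; last by rewrite -ltnS.
  rewrite -mulrA mulrBl; over.
rewrite -mulr_sumr sumrB (sum_shift (tilt z n.+1)); last first.
  by move=> s; rewrite addn1 ltnS => ns; rewrite bin_small.
rewrite -sumrB -mulrA; congr (_ * _).
rewrite big_ord_recr /= bin_small // !mul0r subrr addr0.
transitivity (\sum_(s < n.+1) 'C(n, s)%:R * tilt z n s * (2 * z)); last first.
  by rewrite -mulr_suml sum_bin_tilt exprSr mulrA.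
apply: eq_bigr => s _; rewrite /tilt addn1 subSS.
have sn : (s <= n)%N by rewrite -ltnS.
by rewrite subSn // !exprS; ring.
Qed.

Lemma sum_bin_lin n :
  \sum_(t < n.+2) 'C(n.+1, t)%:R * (2 * t%:R - n.+1%:R) = 0 :> R.
Proof.
rewrite -[RHS](mulr0 (n.+1%:R * 2 ^+ n.+1)) -sum_bin_tilt_lin.
apply: eq_bigr => t _.
by rewrite /tilt addr0 subr0 !expr1n !mulr1.
Qed.

(* AM-GM in place of the Cauchy-Schwarz inequality. *)
Lemma sum_bin_norm_le m (f : nat -> R) (V c : R) : 0 < c ->
  \sum_(t < m.+1) 'C(m, t)%:R * f t ^+ 2 <= 2 ^+ m * V ->
  2 ^- m * \sum_(t < m.+1) 'C(m, t)%:R * `|f t| <= (V / c + c) / 2.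
Proof.
move=> c0 hV.
have p0 : (0 : R) < 2 ^+ m by rewrite exprn_gt0.
rewrite mulrC ler_pdivrMr //.
apply: (@le_trans _ _ (\sum_(t < m.+1) ('C(m, t)%:R * f t ^+ 2 * (c^-1 / 2) +
   'C(m, t)%:R * (c / 2)))).
  apply: ler_sum => t _; rewrite -mulrA -mulrDr ler_wpM2l //.
  rewrite -real_normK ?num_real //; move: (`|f t|) => y.
  rewrite -subr_ge0.
  have -> : y ^+ 2 * (c^-1 / 2) + c / 2 - y = (y - c) ^+ 2 * (c^-1 / 2).
    by field; rewrite gt_eqF.
  by rewrite mulr_ge0 ?sqr_ge0 // divr_ge0 // invr_ge0 ltW.
rewrite big_split /= -!mulr_suml.
have -> : \sum_(t < m.+1) 'C(m, t)%:R = 2 ^+ m :> R.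
  by rewrite -(sum_bin_tilt 0 m); apply: eq_bigr => t _; rewrite /tilt addr0 subr0 !expr1n !mulr1.
have : (\sum_(t < m.+1) 'C(m, t)%:R * f t ^+ 2) * (c^-1 / 2) <= 2 ^+ m * V * (c^-1 / 2).
  by rewrite ler_wpM2r // divr_ge0 // invr_ge0 ltW.
move=> h; apply: (le_trans (lerD h (lexx _))).
by rewrite le_eqVlt; apply/orP; left; apply/eqP; field; rewrite gt_eqF.
Qed.

(** With v = m u, (1 + u)^m <= exp v <= 1 / (1 - v), and (1 + v + 2 v^2) (1 - v) >= 1 for 0 <= v <=
    1/2. *)
Lemma exprn_1D_le (u : R) (m : nat) : 0 <= u -> m%:R * u <= 1 / 2 ->
  (1 + u) ^+ m <= 1 + m%:R * u + 2 * (m%:R * u) ^+ 2.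
Proof.
move=> u0 hv; have v0 : 0 <= m%:R * u by rewrite mulr_ge0.
have h1 : (1 + u) ^+ m <= expR (m%:R * u).
  by rewrite expRM_natl lerXn2r ?nnegrE ?expR_ge0 ?addr_ge0 // expR_ge1Dx.
apply: (le_trans h1); move: (m%:R * u) hv v0 => v hv v0.
have h2 := expR_ge1Dx (- v); have e0 := expR_gt0 v.
have : expR v * (1 - v) <= 1.
  by rewrite -[leRHS](expRxMexpNx_1 v) ler_pM2l.
nra.
Qed.

(** The mean square of 1 - [tilt] under the uniform distribution is (1 + z^2)^m - 1. *)
Lemma tilt_dist_one z m c : m%:R * z ^+ 2 <= 1 / 2 -> 0 < c ->
  2 ^- m * \sum_(t < m.+1) 'C(m, t)%:R * `|1 - tilt z m t| <=
    (2 * (m%:R * z ^+ 2) / c + c) / 2.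
Proof.
move=> hv c0; apply: (sum_bin_norm_le (f := fun t => 1 - tilt z m t)) => //.
have -> : \sum_(t < m.+1) 'C(m, t)%:R * (1 - tilt z m t) ^+ 2 =
   \sum_(t < m.+1) ('C(m, t)%:R * tilt 0 m t - 2 * ('C(m, t)%:R * tilt z m t) +
     'C(m, t)%:R * tilt z m t ^+ 2).
  apply: eq_bigr => t _; rewrite {2}/tilt addr0 subr0 !expr1n; ring.
rewrite big_split sumrB -mulr_sumr /= !sum_bin_tilt sum_bin_tilt_sqr.
have h := exprn_1D_le (sqr_ge0 z) hv.
rewrite -subr_ge0.
rewrite (_ : _ - _ = 2 ^+ m * (1 + 2 * (m%:R * z ^+ 2) - (1 + z ^+ 2) ^+ m)); last by ring.
rewrite mulr_ge0 ?exprn_ge0 //.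
have v0 : 0 <= m%:R * z ^+ 2 by rewrite mulr_ge0 ?sqr_ge0.
nra.
Qed.

(** The function 1 + z (2t - m) is the projection of [tilt] on degree at most 1, so the mean square
    falls to (1 + z^2)^m - 1 - m z^2, which is of second order in m z^2. *)
Lemma tilt_dist_lin z n c : n.+1%:R * z ^+ 2 <= 1 / 2 -> 0 < c ->
  2 ^- n.+1 * \sum_(t < n.+2) 'C(n.+1, t)%:R *
     `|1 + z * (2 * t%:R - n.+1%:R) - tilt z n.+1 t| <=
    (2 * (n.+1%:R * z ^+ 2) ^+ 2 / c + c) / 2.
Proof.
move=> hv c0.
apply: (sum_bin_norm_le (f := fun t => 1 + z * (2 * t%:R - n.+1%:R) - tilt z n.+1 t)) => //.
pose y (t : nat) : R := 2 * t%:R - n.+1%:R.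
have -> : \sum_(t < n.+2) 'C(n.+1, t)%:R *
     (1 + z * (2 * t%:R - n.+1%:R) - tilt z n.+1 t) ^+ 2 =
  \sum_(t < n.+2) ('C(n.+1, t)%:R * tilt 0 n.+1 t +
     z ^+ 2 * ('C(n.+1, t)%:R * y t ^+ 2) + 2 * z * ('C(n.+1, t)%:R * y t) -
     2 * ('C(n.+1, t)%:R * tilt z n.+1 t) -
     2 * z * ('C(n.+1, t)%:R * y t * tilt z n.+1 t) +
     'C(n.+1, t)%:R * tilt z n.+1 t ^+ 2).
  apply: eq_bigr => t _; rewrite -/(y t) [tilt 0 _ _](_ : _ = 1); last first.
    by rewrite /tilt addr0 subr0 !expr1n mulr1.
  ring.
rewrite big_split !sumrB !big_split /= -!mulr_sumr !sum_bin_tilt sum_bin_tilt_sqr.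
rewrite bin_second_moment sum_bin_lin sum_bin_tilt_lin.
have h := exprn_1D_le (sqr_ge0 z) hv.
rewrite -subr_ge0.
rewrite (_ : _ - _ = 2 ^+ n.+1 * (1 + n.+1%:R * z ^+ 2 + 2 * (n.+1%:R * z ^+ 2) ^+ 2 -
   (1 + z ^+ 2) ^+ n.+1)); last by ring.
by rewrite mulr_ge0 ?exprn_ge0 // subr_ge0.
Qed.

End TiltMoments.

(** * How many hidden sets a single query can detect *)

Section FewSeparated.
Variables (R : realType) (M : nat).

(** The sum of absolute values is the inner product of f with the signed sum g of the h i.
    Cauchy-Schwarz with |f| <= 1 then leaves the squared norm of g, that is, the pairwise
    correlations. *)
Lemma sum_norm_corr_sqr (I : finType) (A : {set I}) (h : I -> cube M -> R)
    (f : cube M -> R) : (forall x, -1 <= f x <= 1) ->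
  (\sum_(i in A) `|2 ^- M * \sum_x h i x * f x|) ^+ 2 <=
  \sum_(i in A) \sum_(j in A) `|2 ^- M * \sum_x h i x * h j x|.
Proof.
move=> f1; pose c i := 2 ^- M * \sum_x h i x * f x.
pose g x := \sum_(i in A) Num.sg (c i) * h i x.
have p0 : (0 : R) < 2 ^- M by rewrite invr_gt0 exprn_gt0.
set X := (X in X ^+ 2).
have XE : X = 2 ^- M * \sum_x g x * f x.
  rewrite /g; under [in RHS]eq_bigr => x _ do rewrite mulr_suml.
  rewrite exchange_big /= mulr_sumr /X; apply: eq_bigr => i _.
  rewrite -/(c i) normrEsg /c mulrCA mulr_sumr; congr (_ * _).
  by apply: eq_bigr => x _; rewrite mulrA.
have GE : 2 ^- M * \sum_x g x ^+ 2 =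
    \sum_(i in A) \sum_(j in A) Num.sg (c i) * Num.sg (c j) *
      (2 ^- M * \sum_x h i x * h j x).
  rewrite /g.
  under eq_bigr => x _ do rewrite expr2 mulr_suml.
  rewrite exchange_big /= mulr_sumr; apply: eq_bigr => i _.
  under eq_bigr => x _ do rewrite mulr_sumr.
  rewrite exchange_big /= mulr_sumr; apply: eq_bigr => j _.
  by rewrite mulrCA; congr (_ * _); rewrite mulr_sumr; apply: eq_bigr => x _; ring.
apply: (@le_trans _ _ (2 ^- M * \sum_x g x ^+ 2)); last first.
  rewrite GE; apply: ler_sum => i _; apply: ler_sum => j _.
  apply: (le_trans (ler_norm _)); rewrite normrM ler_piMl //.
  by rewrite normrM !normr_sg mulr_ile1 //; case: (c _ != 0) => //; case: (c _ != 0).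
(* Cauchy-Schwarz from the nonnegativity of the squared norm of g - X f, using that X is itself the
   inner product of g and f. *)
rewrite -subr_ge0; move: X XE => X XE.
apply: (@le_trans _ _ (2 ^- M * \sum_x (g x - X * f x) ^+ 2)).
  apply: mulr_ge0; first exact: ltW.
  by apply: sumr_ge0 => x _; apply: sqr_ge0.
have -> : 2 ^- M * \sum_x (g x - X * f x) ^+ 2 =
    2 ^- M * \sum_x g x ^+ 2 - 2 * X * (2 ^- M * \sum_x g x * f x) +
    X ^+ 2 * (2 ^- M * \sum_x f x ^+ 2).
  rewrite !mulr_sumr -sumrB -big_split /=; apply: eq_bigr => x _; ring.
rewrite -XE.
have : 2 ^- M * \sum_x f x ^+ 2 <= 1.
  rewrite mulrC ler_pdivrMr ?exprn_gt0 // mul1r.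
  apply: (@le_trans _ _ (\sum_(x : cube M) 1)); last first.
    by rewrite sumr_const card_ffun card_bool card_ord natrX.
  by apply: ler_sum => x _; have /andP [] := f1 x; nra.
have : 0 <= X ^+ 2 by apply: sqr_ge0.
nra.
Qed.

Variables (m k : nat) (F : nat -> R) (B delta : R).
Hypotheses (m0 : (0 < m)%N) (delta0 : 0 <= delta).
Hypothesis F0 : forall j, (j <= k)%N -> kraw m F j = 0.
Hypothesis FB : forall t, (t <= m)%N -> `|F t| <= B.

Definition level_distr (S : {set 'I_M}) (x : cube M) : R :=
  2 ^- M * (1 + 2 * delta * F (weight S x)).

Lemma level_distr_distr (S : {set 'I_M}) :
  #|S| = m -> 2 * delta * B <= 1 -> is_distr (level_distr S).
Proof.
move=> Sm dB; split=> [x|].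
  rewrite mulr_ge0 ?invr_ge0 ?exprn_ge0 //.
  have wm : (weight S x <= m)%N by rewrite -Sm weight_le.
  have := FB wm; rewrite ler_norml => /andP [h _].
  have : delta * - B <= delta * F (weight S x) by rewrite ler_wpM2l.
  by move: dB; rewrite -mulrA; lra.
rewrite -mulr_sumr big_split /= -mulr_sumr.
have -> : \sum_(x : cube M) F (weight S x) = 0.
  have := fourier_weight S finset.set0 F.
  rewrite finset.sub0set cards0 Sm F0 // mulr0 => W0; rewrite -[RHS]W0.
  by apply: eq_bigr => x _; rewrite /chi finset.big_set0 mulr1.
rewrite mulr0 addr0 sumr_const card_ffun card_bool card_ord.
by rewrite natrX mulVf // expf_neq0 // pnatr_eq0.
Qed.

(** If A is the set of detected S, then |A|^2 2 tau is at most 4 delta^2 times the sum of the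
    pairwise correlations over A. Pairs of overlap below s contribute at most tau |A|^2 in total.
    The 2 in sqrt (2 tau) lets them be absorbed on the left, and only the rare pairs of large
    overlap remain. *)
Lemma few_separated (s : nat) (tau : R) (f : query R M) : 0 < tau ->
  4 * delta ^+ 2 * B ^+ 2 * (s%:R / m%:R) ^+ k.+1 <= tau ->
  Num.sqrt (2 * tau) <= query_tol f ->
  #|[set S in [set S : {set 'I_M} | #|S| == m] |
       separates (@unif R M) (level_distr S) f]|%:R * tau <=
  4 * delta ^+ 2 * B ^+ 2 * ('C(m, s) * 'C(M - s, m - s))%:R.
Proof.
move=> tau0 htau ftol; set A := [set S in _ | _].
set cnt := ('C(m, s) * 'C(M - s, m - s))%N.
have m0R : (0 : R) < m%:R by rewrite ltr0n.
have B0 : 0 <= B by apply: (le_trans (normr_ge0 (F 0))); apply: FB.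
have p0 : (0 : R) < 2 ^- M by rewrite invr_gt0 exprn_gt0.
pose c S := 2 ^- M * \sum_x F (weight S x) * f x.
have Am S : S \in A -> #|S| = m by rewrite !inE => /andP [/eqP].
have sepE S : S \in A -> Num.sqrt (2 * tau) <= 2 * delta * `|c S|.
  rewrite !inE => /andP [_]; rewrite /separates => h.
  apply: (le_trans ftol); apply: (le_trans (ltW h)).
  have -> : expect (@unif R M) f - expect (level_distr S) f = - (2 * delta * c S).
    rewrite /expect -sumrB /c !mulr_sumr -sumrN; apply: eq_bigr => x _.
    by rewrite unifE /level_distr; ring.
  by rewrite normrN normrM ger0_norm // mulr_ge0.
set rho := (s%:R / m%:R) ^+ k.+1 in htau *.
have rho0 : 0 <= rho by rewrite exprn_ge0 // divr_ge0.
have inner S : S \in A ->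
    \sum_(T in A) `|2 ^- M * \sum_x F (weight S x) * F (weight T x)| <=
    B ^+ 2 * (#|A|%:R * rho + cnt%:R).
  move=> SA; have Sm := Am _ SA.
  (* An overlap below s gives correlation at most B^2 [rho]; for the others the trivial bound B^2 is
     used. *)
  apply: (@le_trans _ _ (\sum_(T in A) (B ^+ 2 * rho + B ^+ 2 * (s <= #|S :&: T|)%N%:R))).
    apply: ler_sum => T TA; have Tm := Am _ TA.
    have cw := corr_weight m0 Sm Tm F0 FB.
    rewrite normrM (ger0_norm (ltW p0)) mulrC ler_pdivrMr ?exprn_gt0 //.
    rewrite mulrC in cw; apply: (le_trans cw).
    rewrite ler_wpM2r ?exprn_ge0 // -mulrDr ler_wpM2l ?sqr_ge0 //.
    have q0 : (0 : R) <= #|S :&: T|%:R / m%:R by rewrite divr_ge0.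
    have [sr|rs] := leqP s #|S :&: T|.
      apply: (@le_trans _ _ 1); last by rewrite lerDr.
      rewrite exprn_ile1 // ler_pdivrMr // mul1r ler_nat -Sm.
      by rewrite subset_leq_card // finset.subsetIl.
    rewrite addr0 lerXn2r ?nnegrE ?divr_ge0 //.
    by rewrite ler_wpM2r ?invr_ge0 // ler_nat ltnW.
  rewrite big_split /= sumr_const -mulr_sumr -mulrnAr -mulrDr ler_wpM2l ?sqr_ge0 //.
  rewrite -[rho *+ _]mulr_natl lerD2l -natr_sum ler_nat.
  apply: leq_trans (card_large_overlap s Sm).
  rewrite -sum1dep_card big_mkcond [leqRHS]big_mkcond /=; apply: leq_sum => T _.
  by case: ifP => // /Am ->; rewrite eqxx /=; case: (s <= _)%N.
have [A0|Apos] := posnP #|A|.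
  by rewrite A0 mul0r !mulr_ge0 ?sqr_ge0.
have A0R : (0 : R) < #|A|%:R by rewrite ltr0n.
set X := \sum_(S in A) `|c S|.
have hX : #|A|%:R * Num.sqrt (2 * tau) <= 2 * delta * X.
  rewrite mulr_natl -sumr_const /X mulr_sumr; apply: ler_sum => S SA.
  exact: sepE.
have X2 : X ^+ 2 <= #|A|%:R * (B ^+ 2 * (#|A|%:R * rho + cnt%:R)).
  apply: (le_trans (sum_norm_corr_sqr A (fun S x => F (weight S x)) (query_range f))).
  rewrite mulr_natl -sumr_const; apply: ler_sum => S SA; exact: inner.
have : (#|A|%:R * Num.sqrt (2 * tau)) ^+ 2 <= (2 * delta * X) ^+ 2.
  rewrite lerXn2r ?nnegrE ?mulr_ge0 ?sqrtr_ge0 //.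
  by apply: sumr_ge0 => S _.
rewrite exprMn sqr_sqrtr ?mulr_ge0 ?(ltW tau0) // [leRHS]exprMn => h1.
have h2 : #|A|%:R ^+ 2 * (2 * tau) <=
    (2 * delta) ^+ 2 * (#|A|%:R * (B ^+ 2 * (#|A|%:R * rho + cnt%:R))).
  by apply: (le_trans h1); rewrite ler_wpM2l ?sqr_ge0.
have h3 : #|A|%:R * (2 * tau) <= 4 * delta ^+ 2 * B ^+ 2 * (#|A|%:R * rho + cnt%:R).
  rewrite -(ler_pM2l A0R).
  apply: le_trans (le_trans h2 _); rewrite le_eqVlt; apply/orP; left; apply/eqP; ring.
have h4 : 4 * delta ^+ 2 * B ^+ 2 * rho * #|A|%:R <= tau * #|A|%:R.
  by rewrite ler_wpM2r // ltW.
lra.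
Qed.

End FewSeparated.

(** * Distances from the biased distribution *)

Section Distances.
Variables (R : realType) (M m : nat) (S : {set 'I_M}) (delta : R).
Hypotheses (m0 : (0 < m)%N) (Sm : #|S| = m) (delta0 : 0 < delta).

Let z : R := 2 * (delta / Num.sqrt m%:R).

Let mz2 : m%:R * z ^+ 2 = 4 * delta ^+ 2.
Proof.
have m0R : (0 : R) < m%:R by rewrite ltr0n.
rewrite /z !exprMn exprVn sqr_sqrtr ?(ltW m0R) //.
by field; rewrite gt_eqF.
Qed.

Lemma dTV_unif_biased : 4 * delta ^+ 2 <= 1 / 2 ->
  dTV (@unif R M) (biased S (delta / Num.sqrt m%:R)) <= 2 * delta.
Proof.
move=> hd.
rewrite (dTV_weight (S := S) (a := fun=> 1) (b := tilt z m)); last 2 first.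
- by move=> x; rewrite unifE mulr1.
- by move=> x; rewrite biasedE Sm.
(* The AM-GM parameter is optimal at sqrt 8 delta; 3 delta is close enough. *)
rewrite Sm; have c0 : 0 < 3 * delta by rewrite mulr_gt0.
have := @tilt_dist_one _ z m _ _ c0; rewrite mz2 => /(_ hd) h.
have -> : 2 * delta = 2^-1 * (4 * delta) by field.
rewrite ler_wpM2l // (le_trans h) //.
have -> : 2 * (4 * delta ^+ 2) / (3 * delta) = 8 / 3 * delta.
  by field; rewrite gt_eqF.
by lra.
Qed.

Lemma dTV_level_biased (F : nat -> R) (e : R) : 4 * delta ^+ 2 <= 1 / 2 ->
  \sum_(t < m.+1) 'C(m, t)%:R * `|F t - (2 * t%:R - m%:R) / Num.sqrt m%:R| <=
     2 ^+ m * e ->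
  dTV (level_distr F delta S) (biased S (delta / Num.sqrt m%:R)) <=
  delta * e + 3 * delta ^+ 2.
Proof.
move=> hd he.
rewrite (dTV_weight (S := S) (a := fun t => 1 + 2 * delta * F t) (b := tilt z m)) //;
  last by move=> x; rewrite biasedE Sm.
rewrite Sm; have p0 : (0 : R) < 2 ^- m by rewrite invr_gt0 exprn_gt0.
(* Here the optimum is sqrt 32 delta^2; 5 delta^2 yields 57/20 delta^2, below the claimed 3
   delta^2. *)
have c0 : 0 < 5 * delta ^+ 2 by rewrite mulr_gt0 ?exprn_gt0.
have [n mn] : exists n, m = n.+1 by case: (m) m0 => // n _; exists n.
have := @tilt_dist_lin _ z n _ _ c0; rewrite -mn mz2 => /(_ hd) h.
have tri : 2 ^- m * \sum_(t < m.+1) 'C(m, t)%:R * `|1 + 2 * delta * F t - tilt z m t| <=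
    2 ^- m * \sum_(t < m.+1) 'C(m, t)%:R *
      `|1 + z * (2 * t%:R - m%:R) - tilt z m t| + 2 * delta * e.
  have he' : 2 * delta * (2 ^- m * \sum_(t < m.+1) 'C(m, t)%:R *
      `|F t - (2 * t%:R - m%:R) / Num.sqrt m%:R|) <= 2 * delta * e.
    rewrite ler_pM2l ?mulr_gt0 // mulrC ler_pdivrMr ?exprn_gt0 // mulrC.
    exact: he.
  apply: le_trans (lerD (lexx _) he').
  rewrite mulrCA -mulrDr ler_pM2l // mulr_sumr -big_split /=.
  apply: ler_sum => t _; rewrite mulrCA -mulrDr ler_wpM2l //.
  have d2 : 0 <= 2 * delta by rewrite mulr_ge0 // ltW.
  rewrite -{2}(ger0_norm d2) -normrM (le_trans _ (ler_normD _ _)) //.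
  by rewrite le_eqVlt; apply/orP; left; apply/eqP; congr (`| _ |); rewrite /z; ring.
have hs : 2 * (4 * delta ^+ 2) ^+ 2 / (5 * delta ^+ 2) = 32 / 5 * delta ^+ 2.
  by field; rewrite gt_eqF.
rewrite hs in h; have d20 : 0 <= delta ^+ 2 by apply: sqr_ge0.
lra.
Qed.

End Distances.

(** * Powers of m and M, and the overlap threshold *)

Section Scales.
Variables (R : realType) (m M : nat).
Hypotheses (m0 : (0 < m)%N) (ME : M%:R = 3 * m%:R `^ (5 / 4) :> R).

Let mu : R := m%:R `^ (1 / 4).

Let mu4 : mu ^+ 4 = m%:R.
Proof.
rewrite -powR_mulrn ?powR_ge0 // -powRrM.
by rewrite (_ : 1 / 4 * 4%:R = 1) ?powRr1 //; field.
Qed.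

Let mu5 : M%:R = 3 * mu ^+ 5.
Proof.
rewrite ME -powR_mulrn ?powR_ge0 // -powRrM.
by congr (_ * _ `^ _); field.
Qed.

Let mu_ge1 : 1 <= mu.
Proof.
rewrite leNgt; apply/negP => lt1.
have : mu ^+ 4 < 1 by rewrite exprn_ilt1 // powR_ge0.
by rewrite mu4 ltNge ler1n m0.
Qed.

Lemma m_le_M : (m <= M)%N.
Proof.
rewrite -(ler_nat R) mu5 -mu4 exprS.
have : 0 <= mu ^+ 4 by rewrite exprn_ge0 // powR_ge0.
have := mu_ge1; nra.
Qed.

(** Here nu = M^(1/5) and s is the least integer above 8 m^2 / M, of order m^(3/4). It has to be
    large enough for [large_overlap_rare] and at least nu^2 / 3, yet small enough that s / m <= 7 /
    nu, so that (s / m)^(k+1) matches the power of M in tau. *)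
Lemma overlap_threshold : (256 <= m)%N -> exists (nu : R) (s : nat),
  [/\ 0 < nu, forall k : nat, M%:R `^ (- (k.+1%:R / 5)) = nu ^- k.+1,
      M%:R `^ (2 / 5) = nu ^+ 2,
      [/\ (s <= m)%N, (8 * m ^ 2 <= s * M)%N & s%:R * nu <= 7 * m%:R] &
      1 / 3 * nu ^+ 2 <= s%:R].
Proof.
move=> m256; have M0 : (0 < M)%N by rewrite (leq_trans m0) // m_le_M.
have M0R : (0 : R) < M%:R by rewrite ltr0n.
pose nu : R := M%:R `^ (1 / 5); pose s := ((8 * m ^ 2) %/ M).+1.
have nu0 : 0 < nu by rewrite powR_gt0.
have nu5 : nu ^+ 5 = M%:R.
  rewrite -powR_mulrn ?powR_ge0 // -powRrM.
  by rewrite (_ : 1 / 5 * 5%:R = 1) ?powRr1 //; field.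
have mu0 : 0 < mu by rewrite (lt_le_trans ltr01).
have mu_ge4 : 4 <= mu.
  rewrite leNgt; apply/negP => lt4.
  have : mu ^+ 4 < 4 ^+ 4 by rewrite ltrXn2r ?ltW.
  by rewrite mu4 -natrX ltr_nat ltnNge m256.
have nu_mu : nu <= 3 / 2 * mu.
  rewrite leNgt; apply/negP => lt.
  have : (3 / 2 * mu) ^+ 5 < nu ^+ 5 by rewrite ltrXn2r // ?mulr_ge0 ?ltW.
  rewrite nu5 mu5 exprMn.
  have : 0 < mu ^+ 5 by rewrite exprn_gt0.
  have -> : (3 / 2 : R) ^+ 5 = 243 / 32 by field.
  by lra.
have sM : (8 * m ^ 2 <= s * M)%N by rewrite ltnW // /s ltn_ceil.
have sM' : (s * M <= 8 * m ^ 2 + M)%N.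
  by rewrite /s mulSn addnC leq_add2r leq_trunc_div.
have mu3 : 0 < mu ^+ 3 by rewrite exprn_gt0.
have p5 : 0 < 3 * mu ^+ 5 by rewrite mulr_gt0 ?exprn_gt0.
have slo : 8 / 3 * mu ^+ 3 <= s%:R.
  rewrite -(ler_pM2r p5) -mu5 -natrM.
  apply: (@le_trans _ _ (8 * m ^ 2)%:R); last by rewrite ler_nat.
  by rewrite natrM natrX -mu4 mu5 le_eqVlt; apply/orP; left; apply/eqP; field.
have shi : s%:R <= 8 / 3 * mu ^+ 3 + 1.
  rewrite -(ler_pM2r p5) -mu5 -natrM.
  apply: (@le_trans _ _ (8 * m ^ 2 + M)%:R); first by rewrite ler_nat.
  by rewrite natrD natrM natrX -mu4 mu5 le_eqVlt; apply/orP; left; apply/eqP; field.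
have mu43 : mu ^+ 4 = mu * mu ^+ 3 by rewrite -exprS.
have mu32 : mu ^+ 3 = mu * mu ^+ 2 by rewrite -exprS.
have mu3_ge1 : 1 <= mu ^+ 3 by rewrite exprn_ege1.
have mu_le4 : 4 * mu ^+ 3 <= mu ^+ 4 by rewrite mu43 ler_pM2r.
exists nu, s; split => //.
- move=> k; rewrite powRN -powR_mulrn ?powR_ge0 // -powRrM.
  by congr (_ `^ _)^-1; ring.
- by rewrite -powR_mulrn ?powR_ge0 // -powRrM; congr (_ `^ _); field.
- split => //; first by rewrite -(ler_nat R) -mu4; lra.
  apply: (@le_trans _ _ ((8 / 3 * mu ^+ 3 + 1) * (3 / 2 * mu))).
    by rewrite ler_pM // ltW.
  have : mu <= mu ^+ 4 by rewrite -[leLHS]expr1 ler_weXn2l.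
  rewrite -mu4 mu43; lra.
apply: le_trans slo.
have : nu ^+ 2 <= (3 / 2 * mu) ^+ 2 by rewrite lerXn2r // nnegrE ?mulr_ge0 // ltW.
rewrite exprMn.
have : mu ^+ 2 <= mu ^+ 3 by rewrite ler_weXn2l.
by lra.
Qed.

End Scales.

Lemma exists_subset_card (M m : nat) : (m <= M)%N ->
  exists S : {set 'I_M}, #|S| = m.
Proof.
rewrite -bin_gt0 -[M in 'C(M, m)]card_ord -card_draws => /card_gt0P [S].
by rewrite inE => /eqP; exists S.
Qed.

(** 392 = 8 * 7 * 7, and 392 <= exp 392 is ample. *)
Lemma expR_dominates (R : realType) (k : nat) (L : R) : (0 < k)%N ->
  392 * k%:R <= L / 16 -> 8 * 7 ^+ k.+1 <= expR (L / 16).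
Proof.
move=> k0 hL.
apply: (@le_trans _ _ (392 ^+ k)).
  have -> : 392 = 56 * 7 :> R by ring.
  rewrite exprMn exprS mulrA; apply: ler_wpM2r; first by rewrite exprn_ge0.
  rewrite (_ : 8 * 7 = 56 :> R); last by ring.
  rewrite -[leLHS]expr1; apply: ler_weXn2l => //.
  by rewrite ler1n.
apply: (@le_trans _ _ (expR (k%:R * 392))); last first.
  by rewrite ler_expR mulrC.
rewrite expRM_natl; apply: lerXn2r.
- by rewrite nnegrE; exact: ler0n.
- by rewrite nnegrE; exact: expR_ge0.
by apply: le_trans (expR_ge1Dx _); lra.
Qed.

(** * Choice of the parameters when sqrt L is large compared with k^2 *)

Section MainCase.
Variables (R : realType) (m M k : nat) (a eps delta theta1 : R).
Let L : R := ln (1 / eps).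
Let w : R := expR (L / 16).
Hypotheses (m0 : (0 < m)%N) (k0 : (0 < k)%N) (th0 : 0 < theta1).
Hypotheses (a0 : 0 < a) (a1 : a <= 1 / 1000) (a2 : a <= theta1 / 36).
Hypotheses (e0 : 0 < eps) (dE : delta = a * (eps * Num.sqrt L / k%:R ^+ 2)).
Hypothesis big : k%:R ^+ 2 / 2 < a * Num.sqrt L.
Hypothesis mL : L ^+ 3 < m%:R.

Let k1 : (1 : R) <= k%:R. Proof. by rewrite ler1n. Qed.
Let k21 : (1 : R) <= k%:R ^+ 2. Proof. by rewrite exprn_ege1. Qed.

Let sL_gt : 500 * k%:R ^+ 2 <= Num.sqrt L.
Proof.
have : a * Num.sqrt L <= 1 / 1000 * Num.sqrt L.
  by rewrite ler_wpM2r ?sqrtr_ge0.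
by move: big; lra.
Qed.

Let sL0 : 0 < Num.sqrt L. Proof. by move: sL_gt k21; lra. Qed.
Let L0 : 0 < L. Proof. by move: sL0; rewrite sqrtr_gt0. Qed.
Let sL2 : Num.sqrt L ^+ 2 = L. Proof. by rewrite sqr_sqrtr // ltW. Qed.

Let L_gt : 500 * (20 * k%:R) <= L.
Proof.
have kk : k%:R <= k%:R ^+ 2 :> R by rewrite -[leLHS]expr1 ler_weXn2l.
rewrite -sL2 expr2; apply: ler_pM.
- exact: ler0n.
- by apply: mulr_ge0; exact: ler0n.
- by move: sL_gt k21; lra.
by move: sL_gt kk k1; lra.
Qed.

Let w1 : 1 <= w.
Proof. by apply: le_trans (expR_ge1Dx _); rewrite lerDl divr_ge0 // ltW. Qed.

Let sL_w : Num.sqrt L <= 2 * w.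
Proof.
have := expR_ge1Dx (L / 16); rewrite -/w; have := sL2.
have : 0 <= (Num.sqrt L / 4 - 1) ^+ 2 by apply: sqr_ge0.
by lra.
Qed.

Let eps_w : eps * w ^+ 16 = 1.
Proof.
rewrite /w -expRM_natl mulrCA divff ?mulr1 ?pnatr_eq0 //.
by rewrite /L lnK ?posrE ?divr_gt0 // div1r divff ?gt_eqF.
Qed.

Let delta_gt0 : 0 < delta.
Proof. by rewrite dE mulr_gt0 // divr_gt0 ?mulr_gt0 // (lt_le_trans ltr01). Qed.

Let delta_le : delta <= a * eps * Num.sqrt L.
Proof.
rewrite dE [leLHS]mulrA [a * (eps * _)]mulrA ler_pdivrMr; last first.
  exact: lt_le_trans k21.
by rewrite ler_peMr // !mulr_ge0 // ltW.
Qed.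

(** With w = eps^(-1/16), delta is at most a eps sqrt L <= 2 a eps w, and eps = w^(-16). So delta
    pays for up to 15 powers of w. *)
Let delta_w : delta * w ^+ 15 <= 2 * a.
Proof.
have w15 : 0 <= w ^+ 15 by rewrite exprn_ge0 // (le_trans ler01).
apply: (@le_trans _ _ (a * eps * Num.sqrt L * w ^+ 15)).
  exact: ler_wpM2r.
apply: (@le_trans _ _ (a * eps * (2 * w) * w ^+ 15)).
  by apply: ler_wpM2r => //; apply: ler_wpM2l => //; rewrite mulr_ge0 // ltW.
rewrite (_ : a * eps * (2 * w) * w ^+ 15 = 2 * a * (eps * w ^+ 16)); last by ring.
by rewrite eps_w mulr1.
Qed.

Let delta_w_le (i : nat) : (i <= 15)%N -> delta * w ^+ i <= 2 * a.
Proof.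
move=> i15; apply: le_trans delta_w; apply: ler_wpM2l; first exact: ltW.
exact: ler_weXn2l.
Qed.

Lemma main_delta_small : 4 * delta ^+ 2 <= 1 / 2 /\ 2 * delta * (3 * w) <= 1.
Proof.
have d0 := delta_gt0.
have := @delta_w_le 0 isT; rewrite expr0 mulr1 => h0.
have := @delta_w_le 1 isT; rewrite expr1 => h1.
split; last by move: a1; lra.
have : delta <= 1 / 4 by move: a1; lra.
by move: d0; nra.
Qed.

Lemma main_corr_small : 4 * delta * (3 * w) ^+ 2 * 7 ^+ k.+1 <= theta1.
Proof.
have hw : 8 * 7 ^+ k.+1 <= w.
  apply: expR_dominates => //; move: L_gt k1; lra.
have w0 : 0 <= w by apply: le_trans w1.
(* Two powers of w come from the squared sup norm and a third absorbs 7^(k+1); [delta_w_le] covers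
   all three. *)
have p : 0 <= 36 * delta * w ^+ 2.
  by rewrite mulr_ge0 ?exprn_ge0 // mulr_ge0 // ltW.
have h : 36 * delta * w ^+ 2 * 7 ^+ k.+1 <= 36 * delta * w ^+ 2 * (w / 8).
  by apply: ler_wpM2l => //; lra.
have := @delta_w_le 3 isT; rewrite exprSr => h3.
have -> : 4 * delta * (3 * w) ^+ 2 * 7 ^+ k.+1 = 36 * delta * w ^+ 2 * 7 ^+ k.+1 by ring.
apply: (le_trans h).
have -> : 36 * delta * w ^+ 2 * (w / 8) = 9 / 2 * (delta * (w ^+ 2 * w)) by field.
by move: a2 th0; lra.
Qed.

Let D : R := Num.sqrt m%:R.
Let m0R : (0 : R) < m%:R. Proof. by rewrite ltr0n. Qed.
Let D0 : 0 < D. Proof. by rewrite sqrtr_gt0. Qed.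
Let D2 : D ^+ 2 = m%:R. Proof. by rewrite sqr_sqrtr // ltW. Qed.

Let L_le_m : L <= m%:R.
Proof.
apply: le_trans (ltW mL); rewrite -[leLHS]expr1; apply: ler_weXn2l => //.
by move: L_gt k1; lra.
Qed.

Lemma main_m_large : (256 <= m)%N.
Proof. by rewrite -(ler_nat R); move: L_le_m L_gt k1; lra. Qed.

Let sL_D : Num.sqrt L <= D.
Proof. by rewrite ler_wsqrtr. Qed.

(** H is the integer part of sqrt L D / (16 k^2). The quotient is at least 2, so rounding loses at
    most a factor 2; L <= m provides 16 K <= m. *)
Lemma main_scale : exists H : nat, [/\ (0 < H)%N,
  (16 * (k ^ 2 * H) <= m)%N,
  (k ^ 2 * H)%:R <= Num.sqrt L * D / 16 &
  Num.sqrt L * D / 32 <= (k ^ 2 * H)%:R].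
Proof.
pose X := Num.sqrt L * D / (16 * k%:R ^+ 2).
have k2 : (0 : R) < k%:R ^+ 2 by apply: lt_le_trans k21.
have D1 : 1 <= D by rewrite -sqrtr1 ler_wsqrtr // ler1n.
have X2 : 2 <= X.
  rewrite ler_pdivlMr; last by apply: mulr_gt0.
  apply: (@le_trans _ _ (Num.sqrt L * 1)).
    by move: sL_gt k21; lra.
  by apply: ler_wpM2l D1; exact: sqrtr_ge0.
have /andP [HX XH] := truncn_itv (le_trans (ler0n R 2) X2).
pose H := Num.trunc X; exists H; rewrite -/H in HX XH.
have H1 : X / 2 <= H%:R by move: XH; rewrite -natr1; move: X2; lra.
have XE : Num.sqrt L * D / 16 = k%:R ^+ 2 * X by rewrite /X; field; rewrite gt_eqF // ltr0n.
have hi : (k ^ 2 * H)%:R <= Num.sqrt L * D / 16.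
  by rewrite natrM natrX XE; apply: ler_wpM2l => //; exact: ltW.
split => //.
- by rewrite -(ltr_nat R); move: H1 X2; lra.
- rewrite -(ler_nat R) [leLHS]natrM -D2.
  have : Num.sqrt L * D <= D * D by apply: ler_wpM2r => //; exact: ltW.
  by rewrite -expr2; move: hi; lra.
rewrite (_ : Num.sqrt L * D / 32 = k%:R ^+ 2 * (X / 2)); last first.
  by rewrite /X; field; rewrite gt_eqF // ltr0n.
by rewrite natrM natrX; apply: ler_wpM2l => //; exact: ltW.
Qed.

Lemma main_level_function : exists F : nat -> R,
  [/\ (k <= m)%N, forall j, (j <= k)%N -> kraw m F j = 0,
      forall t, (t <= m)%N -> `|F t| <= 3 * w &
      forall S : {set 'I_M}, #|S| = m ->
        dTV (level_distr F delta S) (biased S (delta / D)) <= eps].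
Proof.
have [H [H0 Km hi lo]] := main_scale.
pose K := (k ^ 2 * H)%N; rewrite -/K in Km hi lo.
have [n mn] : exists n, m = n.+1 by case: (m) m0 => // n _; exists n.
have Km' : (16 * K <= n.+1)%N by rewrite -mn.
have D2' : D ^+ 2 = n.+1%:R by rewrite -mn.
have [F [F1 F2 F3]] := level_function_exists k0 H0 (erefl K) Km' D0 D2'.
rewrite -mn in F1 F2 F3.
have K0 : 0 < K%:R :> R by rewrite ltr0n muln_gt0 expn_gt0 k0.
have H0R : 0 < H%:R :> R by rewrite ltr0n.
have KE : K%:R = k%:R ^+ 2 * H%:R :> R by rewrite natrM natrX.
have km : (k <= m)%N.
  apply: leq_trans Km; apply: (@leq_trans K); last by rewrite leq_pmull.
  by rewrite /K -mulnA leq_pmulr // muln_gt0 k0.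
have DH : D / H%:R <= 32 * k%:R ^+ 2 / Num.sqrt L.
  rewrite ler_pdivrMr // mulrAC ler_pdivlMr //.
  by move: lo; rewrite KE; lra.
exists F; split => //.
- exact: kraw_eq0.
- move=> t tm; apply: (le_trans (F3 t tm)).
  have r1 : 2 * K%:R / D <= Num.sqrt L / 8.
    by rewrite ler_pdivrMr //; move: hi; lra.
  have r2 : D / K%:R <= 1.
    rewrite ler_pdivrMr // mul1r; apply: le_trans lo.
    have : 32 * D <= Num.sqrt L * D.
      apply: ler_wpM2r; first exact: ltW.
      by move: sL_gt k21; lra.
    lra.
  have r3 : 8 * D / H%:R <= 1.
    rewrite -mulrA.
    have : 32 * k%:R ^+ 2 / Num.sqrt L <= 32 / 500.
      by rewrite ler_pdivrMr //; move: sL_gt; lra.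
    by move: DH; lra.
  (* The exponent is at most 14 K^2 / m <= 14 L / 256 < L / 16; this fixes the 16 in the definition
     of w. *)
  have r4 : (1 + 14 * K%:R / m%:R) ^+ K <= w.
    apply: (@le_trans _ _ (expR (K%:R * (14 * K%:R / m%:R)))).
      rewrite expRM_natl; apply: lerXn2r; last exact: expR_ge1Dx.
        by rewrite nnegrE addr_ge0 // divr_ge0 // mulr_ge0.
      by rewrite nnegrE expR_ge0.
    rewrite ler_expR mulrA ler_pdivrMr // -D2.
    have : K%:R ^+ 2 <= (Num.sqrt L * D / 16) ^+ 2.
      by apply: lerXn2r => //; rewrite nnegrE // divr_ge0 // mulr_ge0 ?sqrtr_ge0 // ltW.
    rewrite !exprMn sL2 exprVn.
    have : 0 <= L * D ^+ 2 by rewrite mulr_ge0 ?sqr_ge0 // ltW.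
    rewrite expr2; lra.
  have r5 : 8 * D / H%:R * (1 + 14 * K%:R / m%:R) ^+ K <= w.
    have r0 : 0 <= (1 + 14 * K%:R / m%:R : R) ^+ K.
      by rewrite exprn_ge0 // addr_ge0 // divr_ge0 // mulr_ge0.
    by apply: le_trans r4; apply: ler_piMl r3.
  by move: r1 r2 r5 sL_w w1; lra.
move=> S Sm; have [d1 _] := main_delta_small.
apply: (le_trans (dTV_level_biased m0 Sm delta_gt0 d1 F2)).
(* The factor k^2 / sqrt L of the L^1 error cancels against delta. With [t3] the total is at most
   160 a eps + 12 a^2 eps, below eps as a <= 1/1000. *)
have t1 : delta * (5 * D / H%:R) <= 160 * a * eps.
  rewrite -[5 * D / _]mulrA.
  apply: (@le_trans _ _ (delta * (5 * (32 * k%:R ^+ 2 / Num.sqrt L)))).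
    apply: ler_wpM2l; first exact: ltW.
    by apply: ler_wpM2l.
  rewrite dE le_eqVlt; apply/orP; left; apply/eqP; field.
  by rewrite !gt_eqF // ltr0n.
have t2 : delta * Num.sqrt L <= 4 * a.
  have := @delta_w_le 1 isT; rewrite expr1 => h.
  have : delta * Num.sqrt L <= delta * (2 * w) by apply: ler_wpM2l => //; exact: ltW.
  lra.
have t3 : delta ^+ 2 <= 4 * a ^+ 2 * eps.
  rewrite expr2; apply: (@le_trans _ _ (delta * (a * eps * Num.sqrt L))).
    by apply: ler_wpM2l delta_le; exact: ltW.
  have : (a * eps) * (delta * Num.sqrt L) <= (a * eps) * (4 * a).
    by apply: ler_wpM2l t2; rewrite mulr_ge0 // ltW.
  lra.
have t4 : a * eps <= 1 / 1000 * eps by apply: ler_wpM2r a1; exact: ltW.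
have t5 : a ^+ 2 * eps <= a * eps.
  by apply: ler_wpM2r; [exact: ltW | move: a0 a1; nra].
move: t1 t3 t4 t5 e0; lra.
Qed.

End MainCase.

Theorem theorem4p3 (R : realType) :
  exists kappa : R, 0 < kappa /\
  forall c : R, 0 < c < 1 / 2 ->
  forall theta1 theta2 : R, 0 < theta1 <= theta2 ->
  exists k0 : nat,
  exists a0 : R, 0 < a0 /\
  forall a : R, 0 < a <= a0 ->
  exists C' : R, 0 < C' /\
  forall k m M : nat, (k0 <= k)%N -> (0 < m)%N -> (0 < M)%N ->
  M%:R = 3 * m%:R `^ (5 / 4) :> R ->
  forall eps delta tau : R,
  0 < eps < 1 / 2 ->
  delta = a * (eps * Num.sqrt (ln (1 / eps)) / k%:R ^+ 2) ->
  theta1 * (M%:R `^ (- (k.+1%:R / 5)) * delta) <= tau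
    <= theta2 * (M%:R `^ (- (k.+1%:R / 5)) * delta) ->
  Num.max (C' * ln (1 / eps) ^+ 3) (k%:R ^+ 2 / ln (1 / delta)) < m%:R ->
  forall (d : measure_display) (T : measurableType d) (Pr : probability T R)
    (A : T -> sq_alg R M),
  distinguishes Pr A (@null_hyp R M) (@alt_hyp R M m delta eps) (2 / 3) ->
  makes_query_better_than A (@null_hyp R M) (@alt_hyp R M m delta eps)
    (Num.sqrt (2 * tau)) \/
  makes_at_least_queries A (@null_hyp R M) (@alt_hyp R M m delta eps)
    (2 `^ (kappa * M%:R `^ (2 / 5)) * M%:R `^ (- (k.+1%:R / 5))).
Proof.
(* The constant of nu^2 / 3 <= s in [overlap_threshold]. *)
exists (1 / 3); split; first by lra.
move=> c _ theta1 theta2 /andP [th1 _].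
(* 1/1000 serves the distance estimates and the lower bound on sqrt L; theta1 / 36 serves
   [main_corr_small]. *)
exists 1%N; exists (Num.min (1 / 1000) (theta1 / 36)); split.
  by rewrite lt_min; apply/andP; split; [lra | rewrite divr_gt0].
move=> a /andP [a0]; rewrite le_min => /andP [a1 a2].
exists 1; split => // k m M k0 m0 M0 ME eps delta tau /andP [e0 e1] dE.
move=> /andP [tau1 _]; rewrite gt_max mul1r => /andP [mL _].
move=> d T Pr A dist.
set L := ln (1 / eps) in dE mL.
have L0 : 0 < L.
  rewrite /L ln_gt0 // ltr_pdivlMr //; lra.
have kR : (0 : R) < k%:R by rewrite ltr0n.
have sL0 : 0 < Num.sqrt L by rewrite sqrtr_gt0.
have d0 : 0 < delta by rewrite dE mulr_gt0 // divr_gt0 ?mulr_gt0 ?exprn_gt0.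
have mM := m_le_M m0 ME.
(* In the first case U_M satisfies both hypotheses, so with positive probability one run would have
   to give both verdicts. *)
have [small|big] := leP (a * Num.sqrt L) (k%:R ^+ 2 / 2).
  have dle : delta <= eps / 2.
    rewrite dE (_ : a * _ = a * Num.sqrt L / k%:R ^+ 2 * eps); last by ring.
    rewrite mulrC; apply: ler_wpM2l; first exact: ltW.
    by rewrite ler_pdivrMr ?exprn_gt0 //; lra.
  have d2 : 4 * delta ^+ 2 <= 1 / 2 by nra.
  have [S Sm] := exists_subset_card mM.
  have alt : alt_hyp m delta eps (@unif R M).
    split; first exact: unif_distr.
    exists S; split => //; apply: (le_trans (dTV_unif_biased m0 Sm d0 d2)); lra.
  have [A0 A1] := dist.
  have st := exact_oracle_stat (@unif R M).
  have [F [mF FS PF]] := prob_ge_inter (A0 _ _ erefl st) (A1 _ _ alt st).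
  have F0 : F = set0.
    by rewrite -subset0 => x /FS [/= ->].
  by move: PF; rewrite F0 measure0 lee_fin; lra.
have [F [km F0 FB dF]] := main_level_function M m0 k0 a0 a1 e0 dE big mL.
have [dsmall dB] := main_delta_small k0 a0 a1 e0 dE big.
have corr := main_corr_small k0 th1 a0 a1 a2 e0 dE big.
have m256 := main_m_large k0 a1 big mL.
have [nu [s [nu0 nuk nu2 [sm big_s snu] s_ge]]] := overlap_threshold m0 ME m256.
set B := 3 * expR (L / 16) in FB dB corr.
rewrite nuk in tau1; rewrite nuk nu2.
have W0 : 0 < nu ^- k.+1 by rewrite invr_gt0 exprn_gt0.
have tau0 : 0 < tau by apply: lt_le_trans tau1; do 2!apply: mulr_gt0 => //.
have m0R : (0 : R) < m%:R by rewrite ltr0n.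
have key : 4 * delta ^+ 2 * B ^+ 2 * (7 ^+ k.+1 * nu ^- k.+1) <= tau.
  apply: le_trans tau1.
  rewrite (_ : _ * (7 ^+ k.+1 * _) =
    (4 * delta * B ^+ 2 * 7 ^+ k.+1) * (nu ^- k.+1 * delta)); last by ring.
  by apply: ler_wpM2r corr; rewrite mulr_ge0 // ltW.
have p0 : 0 <= 4 * delta ^+ 2 * B ^+ 2 by do 2!(apply: mulr_ge0; last exact: sqr_ge0).
have rho : 4 * delta ^+ 2 * B ^+ 2 * (s%:R / m%:R) ^+ k.+1 <= tau.
  apply: le_trans key; apply: ler_wpM2l => //.
  rewrite -exprVn -exprMn; apply: lerXn2r; rewrite ?nnegrE ?divr_ge0 ?(ltW nu0) //.
  by rewrite ler_pdivrMr // mulrAC ler_pdivlMr.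
pose cnt := ('C(m, s) * 'C(M - s, m - s))%N.
pose beta := 4 * delta ^+ 2 * B ^+ 2 * cnt%:R / tau.
pose I := [set S : {set 'I_M} | #|S| == m].
have cardI : #|I| = 'C(M, m) by rewrite card_draws card_ord.
apply: (sq_lower_bound (U := @unif R M) (D := I) (P := level_distr F delta)
  (beta := beta) dist erefl).
- move=> S; rewrite inE => /eqP Sm; split; first exact: (level_distr_distr (ltW d0) F0 FB Sm dB).
  by exists S; split => //; apply: dF.
- move=> f ftol; rewrite /beta ler_pdivlMr //.
  exact: (few_separated m0 (ltW d0) F0 FB tau0 rho ftol).
- by rewrite /beta; apply: divr_ge0; [apply: mulr_ge0 | exact: ltW].
rewrite cardI.
have C0 : (0 : R) < 'C(M, m)%:R by rewrite ltr0n bin_gt0.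
have rare := large_overlap_rare R m0 sm mM big_s.
have two : 2 `^ (1 / 3 * nu ^+ 2) * cnt%:R <= 'C(M, m)%:R.
  apply: (@le_trans _ _ (2 ^+ s * cnt%:R)).
    apply: ler_wpM2r => //; rewrite -(powR_mulrn s) //.
    by apply: ler_powR => //; rewrite ler1n.
  by rewrite -natrX -natrM ler_nat mulnC.
(* As k >= 1, 49 = 7^2 <= 7^(k+1). The slack 49 beats the factor 3 lost to averaging over the
   seed. *)
have frac : 49 * (nu ^- k.+1 * (4 * delta ^+ 2 * B ^+ 2)) <= tau.
  apply: le_trans key.
  have : (49 : R) <= 7 ^+ k.+1.
    have -> : 49 = 7 ^+ 2 :> R by ring.
    by apply: ler_weXn2l => //; rewrite ler1n.
  move=> h; rewrite [leRHS]mulrCA [X in _ <= _ * X]mulrC.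
  by apply: ler_wpM2r h; apply: mulr_ge0 => //; exact: ltW.
set q := nu ^- k.+1 * (4 * delta ^+ 2 * B ^+ 2) in frac.
have -> : 3 * (2 `^ (1 / 3 * nu ^+ 2) * nu ^- k.+1 * beta) =
   3 * (q / tau) * (2 `^ (1 / 3 * nu ^+ 2) * cnt%:R) by rewrite /beta /q; ring.
have q1 : q / tau <= 1 / 49 by rewrite ler_pdivrMr //; lra.
have q0 : 0 <= q / tau by apply: divr_ge0; [apply: mulr_ge0; [exact: ltW|] | exact: ltW].
apply: (@le_lt_trans _ _ (3 * (q / tau) * 'C(M, m)%:R)).
  by apply: ler_wpM2l two; rewrite mulr_ge0.
have : q / tau * 'C(M, m)%:R <= 1 / 49 * 'C(M, m)%:R.
  by apply: ler_wpM2r.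
lra.
Qed.
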